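(* Let $p\ge1$ be an integer and $j$ an odd integer such that $2p+j\ge 2$ and $\gcd(p,2p+j)=1$. Let $i\in\mathbb{Z}$ and let $r$ be an integer with $0\le 2r-1\le 2p+j-2$. Then \begin{align*} (q)_{\infty}^3\,\mathcal{C}_{2i-1,2r-1}^{(p,2p+j)}(q) &=(-1)^{p+1}q^{p(i-r)+\binom{p}{2}}(q)_{\infty}^{3}\,\mathcal{C}_{2i-1-j,\,2p-2r+j-1}^{(p,2p+j)}(q)\\ &\quad +(-1)^{p}q^{\binom{p}{2}+p(i+r)}\sum_{m=1}^{p-1}(-1)^{m}q^{\binom{m+1}{2}-m(i+p+r)}\\ &\qquad \times\left ( j(-q^{m(2p+j)-2pr};q^{2p(2p+j)})-q^{2r(m-p)}j(-q^{m(2p+j)+2pr};q^{2p(2p+j)})\right ) . \end{align*}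
   Context: Throughout $q=e^{2\pi i\tau}$ with $\operatorname{Im}\tau>0$, $q^{a}:=e^{2\pi i a\tau}$ for rational $a$, and $z=e^{2\pi i w}$, $z^{a}:=e^{2\pi i a w}$. Also $(q)_\infty=\prod_{n\ge1}(1-q^n)$, $\binom{n}{2}=n(n-1)/2$, and the theta function is $j(x;q):=\sum_{n\in\mathbb{Z}}(-1)^nq^{\binom n2}x^n$ (the letter $j$ without arguments is an integer). Empty sums are $0$. Characters: for coprime integers $p\ge1$, $p'\ge 2$ put $N=p'/p-2$, and let $0\le\ell\le p'-2$. The character of the admissible irreducible highest weight $A_1^{(1)}$-module of level $N$ and spin $\ell$ is (Weyl–Kac formula) $$\chi_{\ell}^{(p,p')}(z;q)=\frac{\Theta_{\ell+1,p'}(z;q^p)-\Theta_{-(\ell+1),p'}(z;q^p)}{\Theta_{1,2}(z;q)-\Theta_{-1,2}(z;q)},\qquad \Theta_{n,m}(z;q)=\sum_{k\in\mathbb{Z}+n/(2m)}q^{mk^2}z^{-mk}.$$ It is holomorphic in the annulus $|q|<|z|<|q|^{-1}$. String functions: for $N\neq0$ and $m\in2\mathbb{Z}+\ell$, $C_{m,\ell}^{(p,p')}(q)=C^N_{m,\ell}(q)$ is defined by the expansion in that annulus $$\chi_\ell^{(p,p')}(z;q)=\sum_{m\in2\mathbb{Z}+\ell}C_{m,\ell}^{(p,p')}(q)\,q^{\frac{m^2}{4N}}z^{-\frac m2},$$ and the normalized string function is $$\mathcal{C}_{m,\ell}^{(p,p')}(q):=q^{-s_{\lambda,\mu}}C_{m,\ell}^{(p,p')}(q),\qquad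 s_{\lambda,\mu}=-\frac18+\frac{p(\ell+1)^2}{4p'}-\frac{m^2}{4N}.$$ *)

(* Defs.v *)
From Stdlib Require Import Reals ZArith.
From Coquelicot Require Import Coquelicot.

Open Scope R_scope.

(** Functions of [(z; q)] are written as functions of [w] and [tau], where
    [z = exp (2 pi i w)] and [q = exp (2 pi i tau)], because fractional powers
    of [z] and [q] depend on the choice of [w] and [tau].  In particular
    [q |-> q^p] is [tau |-> p * tau]. *)

Definition Cexp (x : C) : C :=
  (exp (Re x) * cos (Im x), exp (Re x) * sin (Im x)).

(** [epow tau a] is [q^a], and [epow w a] is [z^a]. *)
Definition epow (u : C) (a : R) : C :=
  Cexp (RtoC (2 * PI) * Ci * RtoC a * u)%C.

Definition Cpowz (x : C) (n : Z) : C :=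
  match n with
  | Z0 => RtoC 1
  | Zpos k => Cpow x (Pos.to_nat k)
  | Zneg k => Cinv (Cpow x (Pos.to_nat k))
  end.

Definition is_Zsum (a : Z -> C) (s : C) : Prop :=
  exists s1 s2 : C,
    is_series (V := C_R_NormedModule) (fun n : nat => a (Z.of_nat n)) s1 /\
    is_series (V := C_R_NormedModule) (fun n : nat => a (- Z.of_nat (S n))%Z) s2 /\
    s = Cplus s1 s2.

(** [iota P] is the unique element satisfying [P], if there is one. *)
Definition Zsum (a : Z -> C) : C :=
  iota (T := C_R_CompleteNormedModule) (is_Zsum a).

(** The division is exact; for [n < 0] too the value is the nonnegative
    integer [n (n - 1) / 2]. *)
Definition binom2 (n : Z) : Z := (n * (n - 1) / 2)%Z.

Fixpoint qpoch (q : C) (n : nat) : C :=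
  match n with
  | O => RtoC 1
  | S k => (qpoch q k * (RtoC 1 - Cpow q (S k)))%C
  end.

Definition qpoch_inf (q : C) : C :=
  iota (T := C_R_CompleteNormedModule)
    (fun l => filterlim (qpoch q) eventually (locally l)).

Definition jtheta (x q : C) : C :=
  Zsum (fun n => (Cpowz (RtoC (-1)) n * Cpowz q (binom2 n) * Cpowz x n)%C).

Definition Theta (n m : Z) (w tau : C) : C :=
  Zsum (fun k0 =>
    let k := IZR k0 + IZR n / (2 * IZR m) in
    (epow tau (IZR m * k ^ 2) * epow w (- (IZR m * k)))%C).

Definition WK_num (p p' l : Z) (w tau : C) : C :=
  (Theta (l + 1) p' w (RtoC (IZR p) * tau)
   - Theta (- (l + 1)) p' w (RtoC (IZR p) * tau))%C.

Definition WK_den (w tau : C) : C := (Theta 1 2 w tau - Theta (-1) 2 w tau)%C.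

Definition chi (p p' l : Z) (w tau : C) : C :=
  (WK_num p p' l w tau / WK_den w tau)%C.

Definition level (p p' : Z) : R := IZR p' / IZR p - 2.

(** [c] is the family of coefficients in the expansion of the character in the
    annulus [|q| < |z| < |q|^-1]; the summation index is [m = 2 k + l].
    In this annulus the denominator vanishes only at [z = 1], where the
    character has a removable singularity; there the quotient [chi] does not
    give the value of the character and the point is left out. *)
Definition is_string_family (p p' l : Z) (tau : C) (c : Z -> C) : Prop :=
  forall w : C,
    Cmod (epow tau 1) < Cmod (epow w 1) < / Cmod (epow tau 1) ->
    WK_den w tau <> RtoC 0 ->
    is_Zsum
      (fun k =>
         let m := (2 * k + l)%Z in
         (c m * epow tau (IZR m ^ 2 / (4 * level p p')) * epow w (- (IZR m / 2)))%C)
      (chi p p' l w tau).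

(** The string function [C_{m,l}^{(p,p')}(q)], meaningful for [m = l] modulo 2:
    only these values of a family are determined by [is_string_family]. *)
Definition string_fun (p p' m l : Z) (tau : C) : C :=
  iota (T := C_R_CompleteNormedModule)
    (fun x => exists c : Z -> C, is_string_family p p' l tau c /\ x = c m).

Definition s_exp (p p' m l : Z) : R :=
  - (1 / 8) + IZR p * IZR (l + 1) ^ 2 / (4 * IZR p')
  - IZR m ^ 2 / (4 * level p p').

Definition nstring_fun (p p' m l : Z) (tau : C) : C :=
  (epow tau (- s_exp p p' m l) * string_fun p p' m l tau)%C.

(* Main.v *)
Require Import Defs.
From Stdlib Require Import Reals ZArith List Permutation Lra Lia.
From Stdlib Require Import ClassicalEpsilon FunctionalExtensionality.
From Coquelicot Require Import Coquelicot.

(** Write [A_a = sum_(n >= 0) (-1)^n q^(n(n+1)/2 + a n)] for [a] in [Z].  The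
    partial fraction expansion of the reciprocal theta function gives
    [(q)^3 / j(z; q) = sum_a A_a z^a] on [|q| < |z| < 1]; in coefficients this is
    [sum_l (-1)^l q^(l(l-1)/2) A_(u-l) = (q)^3 delta_(u,0)], a consequence of
    [A_a + q^(a+1) A_(a+1) = 1] and of Jacobi's identity for [(q)^3].
    Dividing the numerator of the character by [j(z; q)] term by term, the poles
    at [z = 1] cancel and the expansion is valid on the whole annulus, so
    [(q)^3 C_(m,l) = sum_k q^(p p' k^2 + p k (l+1))
       (A_((l-m)/2 + p' k) - A_(-(l+m)/2 - 1 - p' k))].
    Iterating the recurrence [p] times writes [A_(a-p)] as a sum of [p] monomials
    plus a monomial times [A_a].  Applied to the second string function, the terms
    in [A_a] reproduce the first one, and summing the monomials over [k] gives the
    theta functions; the contribution of the first monomial vanishes because of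
    [j(1/x; q) = - j(x; q) / x]. *)

Open Scope R_scope.

(** * Summable families *)

(** A [Zsum] is a pair of one-sided series, a form unsuited to reindexing and to exchanging double
    sums. Sums are therefore handled as limits over finite subsets, where bijections are harmless
    and Fubini is available; absolute summability carries the results back. Three points are more
    than formal. The definition of the string functions only asks that some Laurent expansion
    converge, so uniqueness of the coefficients has to be proved: terms bounded on two circles give
    absolute convergence between them, and averaging over finitely many angles replaces the contour
    integral. The constant [(q)^3] comes from the finite product [(x; q)_(2n+1)], which has a simple
    zero at [x = q^(-n)]: its derivative there is a product, and dominated convergence gives
    Jacobi's identity. The cancelled pole at [z = 1] shows up as a bound: [A_(u-a) - A_(u-b)] decays
    like [|q|^|u|] in both directions, which is exactly what the annulus requires. *)

Definition csum {T : Type} (f : T -> C) (L : list T) : C :=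
  fold_right (fun x s => Cplus (f x) s) (RtoC 0) L.

Definition rsum {T : Type} (f : T -> R) (L : list T) : R :=
  fold_right (fun x s => f x + s) 0 L.

(** Duplicate-free lists play the role of finite subsets of an arbitrary index type; removing
    duplicates needs this classical test. *)
Definition classic_dec {T : Type} (x y : T) : {x = y} + {x <> y} :=
  excluded_middle_informative (x = y).

Lemma csum_app {T} (f : T -> C) L L' : csum f (L ++ L') = (csum f L + csum f L')%C.
Proof. induction L as [|a L IH]; simpl; [|rewrite IH]; ring. Qed.

Lemma csum_ext {T} (f g : T -> C) L :
  (forall x, In x L -> f x = g x) -> csum f L = csum g L.
Proof.
induction L as [|a L IH]; simpl; intros H; [easy|].
rewrite H, IH by auto; easy.
Qed.

Lemma csum_zero {T} (f : T -> C) L : (forall x, In x L -> f x = RtoC 0) -> csum f L = RtoC 0.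
Proof.
induction L as [|a L IH]; simpl; intros H; [easy|].
rewrite H, IH by auto; ring.
Qed.

Lemma csum_plus {T} (f g : T -> C) L :
  csum (fun x => (f x + g x)%C) L = (csum f L + csum g L)%C.
Proof. induction L as [|a L IH]; simpl; [|rewrite IH]; ring. Qed.

Lemma csum_scal {T} c (f : T -> C) L : csum (fun x => (c * f x)%C) L = (c * csum f L)%C.
Proof. induction L as [|a L IH]; simpl; [|rewrite IH]; ring. Qed.

Lemma csum_map {S T} (h : S -> T) (f : T -> C) L :
  csum f (map h L) = csum (fun x => f (h x)) L.
Proof. induction L as [|a L IH]; simpl; [|rewrite IH]; easy. Qed.

Lemma csum_RtoC {T} (f : T -> R) L : csum (fun x => RtoC (f x)) L = RtoC (rsum f L).
Proof. induction L as [|a L IH]; simpl; [easy|]. rewrite IH, RtoC_plus; easy. Qed.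

Lemma Cmod_csum_le {T} (f : T -> C) (g : T -> R) L :
  (forall x, Cmod (f x) <= g x) -> Cmod (csum f L) <= rsum g L.
Proof.
intros H; induction L as [|a L IH]; simpl.
- rewrite Cmod_0; lra.
- eapply Rle_trans; [apply Cmod_triangle|]. specialize (H a); lra.
Qed.

Lemma rsum_app {T} (f : T -> R) L L' : rsum f (L ++ L') = rsum f L + rsum f L'.
Proof. induction L as [|a L IH]; simpl; [|rewrite IH]; ring. Qed.

Lemma rsum_scal {T} c (f : T -> R) L : rsum (fun x => c * f x) L = c * rsum f L.
Proof. induction L as [|a L IH]; simpl; [|rewrite IH]; ring. Qed.

Lemma rsum_le {T} (f g : T -> R) L : (forall x, f x <= g x) -> rsum f L <= rsum g L.
Proof.
intros H; induction L as [|a L IH]; simpl; [lra|]. specialize (H a); lra.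
Qed.

Lemma rsum_map {S T} (h : S -> T) (f : T -> R) L :
  rsum f (map h L) = rsum (fun x => f (h x)) L.
Proof. induction L as [|a L IH]; simpl; [|rewrite IH]; easy. Qed.

Lemma rsum_ge0 {T} (f : T -> R) L : (forall x, 0 <= f x) -> 0 <= rsum f L.
Proof.
intros H; induction L as [|a L IH]; simpl; [lra|]. specialize (H a); lra.
Qed.

Lemma rsum_incl {T} (f : T -> R) L L' :
  (forall x, 0 <= f x) -> NoDup L -> incl L L' -> rsum f L <= rsum f L'.
Proof.
intros Hf HL; revert L'; induction HL as [|a L Ha HL IH]; intros L' Hi; simpl.
- apply rsum_ge0; auto.
- destruct (in_split a L') as (l1 & l2 & ->); [apply Hi; left; easy|].
  assert (H : rsum f L <= rsum f (l1 ++ l2)).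
  { apply IH. intros x Hx.
    assert (Hx' := Hi x (or_intror Hx)).
    apply in_app_or in Hx'; apply in_or_app.
    destruct Hx' as [|[->|]]; auto; contradiction. }
  rewrite rsum_app in *; simpl; lra.
Qed.

Lemma rsum_filter {T} (f : T -> R) (P : T -> bool) L :
  rsum f L = rsum f (filter P L) + rsum f (filter (fun x => negb (P x)) L).
Proof.
induction L as [|a L IH]; simpl; [lra|].
destruct (P a); simpl; lra.
Qed.

Lemma NoDup_cover {T} (L : list T) : exists L', NoDup L' /\ incl L L'.
Proof.
exists (nodup classic_dec L); split; [apply NoDup_nodup|].
intros x; apply nodup_In.
Qed.

(** This is the splitting into a fixed finite part and a disjoint remainder on which the tail
    estimates rest. *)
Lemma NoDup_extend {T} (L0 L : list T) : NoDup L0 ->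
  exists L', NoDup (L0 ++ L') /\ NoDup L' /\ incl L (L0 ++ L') /\
    (forall x, In x L' -> ~ In x L0) /\ incl L' L.
Proof.
intros H0.
set (P := fun x => if in_dec classic_dec x L0 then false else true).
assert (HP : forall x, In x (filter P (nodup classic_dec L)) <-> In x L /\ ~ In x L0).
{ intros x; rewrite filter_In, nodup_In; unfold P.
  destruct (in_dec classic_dec x L0); intuition discriminate. }
assert (HN : NoDup (filter P (nodup classic_dec L))) by apply NoDup_filter, NoDup_nodup.
exists (filter P (nodup classic_dec L)); split; [|split; [|split; [|split]]]; auto.
- apply NoDup_app; auto. intros x Hx Hx'; apply HP in Hx'; tauto.
- intros x Hx; apply in_or_app.
  destruct (in_dec classic_dec x L0); [left|right; apply HP]; auto.
- intros x Hx; apply HP in Hx; tauto.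
- intros x Hx; apply HP in Hx; tauto.
Qed.

(** * Unordered sums and absolute summability *)

Definition has_sum {T : Type} (f : T -> C) (s : C) : Prop :=
  forall eps : R, 0 < eps -> exists L0, forall L, NoDup L -> incl L0 L ->
    Cmod (csum f L - s)%C < eps.

Definition summable {T : Type} (f : T -> R) : Prop :=
  exists M, forall L, NoDup L -> rsum f L <= M.

Definition abs_summable {T : Type} (f : T -> C) : Prop := summable (fun x => Cmod (f x)).

Lemma Cmod_eq_of_small (x y : C) : (forall eps, 0 < eps -> Cmod (x - y)%C <= eps) -> x = y.
Proof.
intros H. assert (E : Cmod (x - y)%C = 0).
{ apply Rle_antisym; [|apply Cmod_ge_0].
  apply Rle_plus_epsilon. intros e He; rewrite Rplus_0_l; auto. }
apply Cmod_eq_0 in E. replace x with ((x - y) + y)%C by ring. rewrite E; ring.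
Qed.

Lemma has_sum_unique {T} (f : T -> C) s t : has_sum f s -> has_sum f t -> s = t.
Proof.
intros Hs Ht; apply Cmod_eq_of_small; intros e He.
destruct (Hs (e / 2)) as [L1 H1]; [lra|]. destruct (Ht (e / 2)) as [L2 H2]; [lra|].
destruct (NoDup_cover (L1 ++ L2)) as (L & HL & Hi).
apply incl_app_inv in Hi as [Hi1 Hi2].
specialize (H1 L HL Hi1); specialize (H2 L HL Hi2).
replace (s - t)%C with (- (csum f L - s) + (csum f L - t))%C by ring.
eapply Rle_trans; [apply Cmod_triangle|]. rewrite Cmod_opp; lra.
Qed.

Lemma has_sum_ext {T} (f g : T -> C) s : (forall x, f x = g x) -> has_sum f s -> has_sum g s.
Proof. intros H; rewrite (functional_extensionality _ _ H); easy. Qed.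

Lemma summable_le {T} (f g : T -> R) : (forall x, f x <= g x) -> summable g -> summable f.
Proof.
intros H [M HM]; exists M; intros L HL. eapply Rle_trans; [apply rsum_le, H|auto].
Qed.

Lemma abs_summable_le {T} (f : T -> C) (g : T -> R) :
  (forall x, Cmod (f x) <= g x) -> summable g -> abs_summable f.
Proof. apply summable_le. Qed.

Lemma summable_scal {T} c (f : T -> R) : 0 <= c -> summable f -> summable (fun x => c * f x).
Proof.
intros Hc [M HM]; exists (c * M); intros L HL. rewrite rsum_scal.
apply Rmult_le_compat_l; auto.
Qed.

Lemma abs_summable_ext {T} (f g : T -> C) : (forall x, f x = g x) -> abs_summable f -> abs_summable g.
Proof. intros H; rewrite (functional_extensionality _ _ H); easy. Qed.

Lemma abs_summable_scal {T} c (f : T -> C) :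
  abs_summable f -> abs_summable (fun x => (c * f x)%C).
Proof.
intros Hf; eapply abs_summable_le; [|exact (summable_scal _ _ (Cmod_ge_0 c) Hf)].
intros x; rewrite Cmod_mult; lra.
Qed.

Lemma summable_inj {S T} (h : S -> T) (f : T -> R) :
  (forall x y, h x = h y -> x = y) -> summable f -> summable (fun x => f (h x)).
Proof.
intros Hh [M HM]; exists M; intros L HL. rewrite <- rsum_map. apply HM.
apply FinFun.Injective_map_NoDup; auto.
Qed.

Lemma abs_summable_inj {S T} (h : S -> T) (f : T -> C) :
  (forall x y, h x = h y -> x = y) -> abs_summable f -> abs_summable (fun x => f (h x)).
Proof. intros Hh; apply (summable_inj h (fun x => Cmod (f x)) Hh). Qed.

Lemma has_sum_plus {T} (f g : T -> C) s t :
  has_sum f s -> has_sum g t -> has_sum (fun x => (f x + g x)%C) (s + t)%C.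
Proof.
intros Hf Hg e He.
destruct (Hf (e / 2)) as [L1 H1]; [lra|]. destruct (Hg (e / 2)) as [L2 H2]; [lra|].
exists (L1 ++ L2); intros L HL Hi. apply incl_app_inv in Hi as [Hi1 Hi2].
specialize (H1 L HL Hi1); specialize (H2 L HL Hi2). rewrite csum_plus.
replace (csum f L + csum g L - (s + t))%C with ((csum f L - s) + (csum g L - t))%C by ring.
eapply Rle_lt_trans; [apply Cmod_triangle|lra].
Qed.

Lemma has_sum_scal {T} c (f : T -> C) s :
  has_sum f s -> has_sum (fun x => (c * f x)%C) (c * s)%C.
Proof.
intros Hf e He. assert (Hc := Cmod_ge_0 c).
destruct (Hf (e / (Cmod c + 1))) as [L0 H0]; [apply Rdiv_lt_0_compat; lra|].
exists L0; intros L HL Hi. rewrite csum_scal.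
replace (c * csum f L - c * s)%C with (c * (csum f L - s))%C by ring.
rewrite Cmod_mult. specialize (H0 L HL Hi).
apply Rle_lt_trans with (Cmod c * (e / (Cmod c + 1))).
- apply Rmult_le_compat_l; lra.
- apply Rmult_lt_reg_r with (Cmod c + 1); [lra|].
  replace (Cmod c * (e / (Cmod c + 1)) * (Cmod c + 1)) with (Cmod c * e) by (field; lra).
  nra.
Qed.

Lemma has_sum_opp {T} (f : T -> C) s : has_sum f s -> has_sum (fun x => (- f x)%C) (- s)%C.
Proof.
intros H; apply (has_sum_scal (- (1))%C) in H.
replace (- s)%C with (- (1) * s)%C by ring.
revert H; apply has_sum_ext; intros x; ring.
Qed.

Lemma has_sum_minus {T} (f g : T -> C) s t :
  has_sum f s -> has_sum g t -> has_sum (fun x => (f x - g x)%C) (s - t)%C.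
Proof. intros Hf Hg; apply has_sum_plus, has_sum_opp; auto. Qed.

Lemma has_sum_finite {T} (f : T -> C) L :
  NoDup L -> (forall x, ~ In x L -> f x = RtoC 0) -> has_sum f (csum f L).
Proof.
intros HL Hf e He; exists L; intros L1 H1 Hi.
destruct (NoDup_extend L L1 HL) as (L2 & H2 & H3 & H4 & H5 & H6).
assert (E : csum f L1 = csum f (L ++ L2)).
{ assert (P : Permutation L1 (L ++ L2)).
  { apply NoDup_Permutation; auto. intros x; split; [apply H4|].
    intros Hx; apply in_app_or in Hx as [Hx|Hx]; auto. }
  clear - P; induction P; simpl; try rewrite IHP; try congruence; ring. }
rewrite E, csum_app, (csum_zero f L2) by auto.
replace (csum f L + 0 - csum f L)%C with (RtoC 0) by ring. rewrite Cmod_0; easy.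
Qed.

Lemma has_sum_single {T} (f : T -> C) x0 :
  (forall x, x <> x0 -> f x = RtoC 0) -> has_sum f (f x0).
Proof.
intros H. replace (f x0) with (csum f (x0 :: nil)) by (simpl; ring).
apply has_sum_finite.
- repeat constructor; easy.
- intros x Hx; apply H; intros ->; apply Hx; left; easy.
Qed.

Lemma has_sum_zero {T} : has_sum (fun _ : T => RtoC 0) (RtoC 0).
Proof. apply (has_sum_finite (fun _ : T => RtoC 0) nil); [constructor|easy]. Qed.

Lemma has_sum_inj {S T} (h : S -> T) (f : T -> C) s :
  (forall x y, h x = h y -> x = y) ->
  (forall x, f x = RtoC 0 \/ exists y, x = h y) ->
  has_sum f s -> has_sum (fun x => f (h x)) s.
Proof.
intros Hh Hf Hs e He. destruct (Hs e He) as [L0 H0].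
assert (HL1 : exists L1, forall x, In x L0 -> f x = RtoC 0 \/ exists y, In y L1 /\ x = h y).
{ clear - Hf; induction L0 as [|a L0 [L1 IH]]; [exists nil; easy|].
  destruct (Hf a) as [Ha|[y Hy]].
  - exists L1; intros x [<-|Hx]; auto.
  - exists (y :: L1); intros x [<-|Hx].
    + right; exists y; split; [left|]; easy.
    + destruct (IH x Hx) as [|(z & Hz & Ez)]; auto.
      right; exists z; split; [right|]; easy. }
destruct HL1 as [L1 H1]. exists L1; intros L HL Hi.
assert (HN : NoDup (map h L)) by (apply FinFun.Injective_map_NoDup; auto).
destruct (NoDup_extend (map h L) L0 HN) as (L2 & A2 & A3 & A4 & A5 & A6).
specialize (H0 _ A2 A4). rewrite csum_app, csum_map, (csum_zero f L2) in H0.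
- rewrite Cplus_0_r in H0; easy.
- intros x Hx. destruct (H1 x (A6 x Hx)) as [|(y & Hy & ->)]; auto.
  exfalso; apply (A5 _ Hx), in_map, Hi, Hy.
Qed.

Lemma has_sum_bij {S T} (h : S -> T) (k : T -> S) (f : T -> C) s :
  (forall x, k (h x) = x) -> (forall y, h (k y) = y) ->
  has_sum f s -> has_sum (fun x => f (h x)) s.
Proof.
intros H1 H2; apply has_sum_inj.
- intros x y E; rewrite <- (H1 x), E; auto.
- intros x; right; exists (k x); rewrite H2; easy.
Qed.

(** A finite set whose sum is within [eps] of the supremum leaves at most [eps] for any disjoint
    finite set. *)
Lemma summable_tail {T} (f : T -> R) eps : (forall x, 0 <= f x) -> summable f -> 0 < eps ->
  exists L0, NoDup L0 /\ forall L, NoDup L -> (forall x, In x L -> ~ In x L0) -> rsum f L <= eps.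
Proof.
intros Hf [M HM] He.
destruct (completeness (fun r => exists L, NoDup L /\ r = rsum f L)) as [s [Hs1 Hs2]].
- exists M; intros r (L & HL & ->); auto.
- exists 0, nil; split; [constructor|easy].
- destruct (excluded_middle_informative (exists L, NoDup L /\ s - eps < rsum f L))
    as [(L0 & H0 & H1)|H].
  + exists L0; split; auto. intros L HL Hd.
    assert (H : rsum f (L0 ++ L) <= s).
    { apply Hs1; exists (L0 ++ L); split; auto. apply NoDup_app; auto.
      intros x Hx Hx'; apply (Hd x); auto. }
    rewrite rsum_app in H; lra.
  + exfalso. assert (s <= s - eps); [|lra].
    apply Hs2. intros r (L & HL & ->). apply Rnot_lt_le. intros Hr; apply H; eauto.
Qed.

Lemma has_sum_nonneg {T} (f : T -> R) : (forall x, 0 <= f x) -> summable f ->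
  exists s, has_sum (fun x => RtoC (f x)) (RtoC s).
Proof.
intros Hf [M HM].
destruct (completeness (fun r => exists L, NoDup L /\ r = rsum f L)) as [s [Hs1 Hs2]].
- exists M; intros r (L & HL & ->); auto.
- exists 0, nil; split; [constructor|easy].
- exists s; intros e He.
  destruct (excluded_middle_informative (exists L, NoDup L /\ s - e < rsum f L))
    as [(L0 & H0 & H1)|H].
  + exists L0; intros L HL Hi. rewrite csum_RtoC, <- RtoC_minus, Cmod_R.
    assert (H2 := rsum_incl f L0 L Hf H0 Hi).
    assert (H3 : rsum f L <= s) by (apply Hs1; exists L; auto).
    rewrite Rabs_left1; lra.
  + exfalso. assert (s <= s - e); [|lra].
    apply Hs2. intros r (L & HL & ->). apply Rnot_lt_le. intros Hr; apply H; eauto.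
Qed.

(** The real and imaginary parts are differences of nonnegative summable families, as in
    [Re f = (|f| + Re f) - |f|]. *)
Lemma has_sum_exists {T} (f : T -> C) : abs_summable f -> exists s, has_sum f s.
Proof.
intros Hf.
assert (Hm := fun x => Cmod_ge_0 (f x)).
assert (Hre := fun x => re_le_Cmod (f x)).
assert (Him : forall x, Rabs (Im (f x)) <= Cmod (f x)).
{ intros x. eapply Rle_trans; [|apply Rmax_Cmod]. apply Rmax_r. }
assert (H2 : summable (fun x => 2 * Cmod (f x))) by (apply summable_scal; [lra|exact Hf]).
destruct (has_sum_nonneg (fun x => Cmod (f x)) Hm Hf) as [s0 H0].
destruct (has_sum_nonneg (fun x => Cmod (f x) + Re (f x))) as [s1 H1].
{ intros x; specialize (Hre x). apply Rabs_le_between in Hre; lra. }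
{ revert H2; apply summable_le; intros x; specialize (Hre x).
  apply Rabs_le_between in Hre; lra. }
destruct (has_sum_nonneg (fun x => Cmod (f x) + Im (f x))) as [s3 H3].
{ intros x; specialize (Him x). apply Rabs_le_between in Him; lra. }
{ revert H2; apply summable_le; intros x; specialize (Him x).
  apply Rabs_le_between in Him; lra. }
exists ((s1 - s0) + Ci * (s3 - s0))%C.
apply (has_sum_ext (fun x => (RtoC (Cmod (f x) + Re (f x)) - RtoC (Cmod (f x)))
  + Ci * (RtoC (Cmod (f x) + Im (f x)) - RtoC (Cmod (f x))))%C).
{ intros x. rewrite !RtoC_plus. rewrite (surjective_pairing (f x)) at 7.
  unfold Ci, RtoC, Cplus, Cminus, Copp, Cmult, Re, Im; simpl. f_equal; ring. }
apply has_sum_plus; [|apply has_sum_scal]; apply has_sum_minus; auto.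
Qed.

Lemma has_sum_tail {T} (f : T -> C) (g : T -> R) s L0 eps :
  has_sum f s -> (forall x, Cmod (f x) <= g x) -> NoDup L0 ->
  (forall L, NoDup L -> (forall x, In x L -> ~ In x L0) -> rsum g L <= eps) ->
  Cmod (s - csum f L0)%C <= eps.
Proof.
intros Hs Hg H0 Ht. apply Rle_plus_epsilon; intros e He.
destruct (Hs e He) as [L1 H1].
destruct (NoDup_extend L0 L1 H0) as (L2 & A2 & A3 & A4 & A5 & A6).
specialize (H1 _ A2 A4). rewrite csum_app in H1.
replace (s - csum f L0)%C with (csum f L2 + - (csum f L0 + csum f L2 - s))%C by ring.
eapply Rle_trans; [apply Cmod_triangle|]. rewrite Cmod_opp.
assert (Cmod (csum f L2) <= eps); [|lra].
eapply Rle_trans; [apply Cmod_csum_le, Hg|auto].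
Qed.

Lemma has_sum_bound {T} (f : T -> C) s M :
  has_sum f s -> (forall L, NoDup L -> rsum (fun x => Cmod (f x)) L <= M) -> Cmod s <= M.
Proof.
intros Hs HM. replace s with (s - csum f nil)%C by (simpl; ring).
apply (has_sum_tail f (fun x => Cmod (f x))); auto; [intros; lra|constructor].
Qed.

(** * Sequential limits, dominated convergence and double sums *)

Definition seq_lim (u : nat -> C) (l : C) : Prop :=
  forall eps, 0 < eps -> exists N, forall n, (N <= n)%nat -> Cmod (u n - l)%C < eps.

(** Tannery's theorem: a finite set [L0] carries all but [e / 4] of the majorant, uniformly in [n],
    and on [L0] the convergence is termwise. *)
Lemma has_sum_dominated {T} (f : nat -> T -> C) (g : T -> C) (G : T -> R) (S : nat -> C) s :
  summable G -> (forall n x, Cmod (f n x) <= G x) ->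
  (forall x, seq_lim (fun n => f n x) (g x)) ->
  (forall n, has_sum (f n) (S n)) -> has_sum g s -> seq_lim S s.
Proof.
intros HG Hf Hl HS Hs e He.
assert (Hg : forall x, Cmod (g x) <= G x).
{ intros x; apply Rle_plus_epsilon; intros d Hd. destruct (Hl x d Hd) as [N HN].
  specialize (HN N (le_n N)). specialize (Hf N x).
  replace (g x) with (f N x + - (f N x - g x))%C by ring.
  eapply Rle_trans; [apply Cmod_triangle|]. rewrite Cmod_opp; lra. }
assert (HG0 : forall x, 0 <= G x) by (intros x; eapply Rle_trans; [apply Cmod_ge_0|apply (Hf O x)]).
destruct (summable_tail G (e / 4) HG0 HG) as (L0 & H0 & Ht); [lra|].
assert (HN : forall d L, 0 < d -> exists N, forall n, (N <= n)%nat ->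
   Cmod (csum (f n) L - csum g L)%C < d).
{ intros d L; revert d; induction L as [|a L IH]; intros d Hd; simpl.
  - exists O; intros n _. replace (0 - 0)%C with (RtoC 0) by ring. rewrite Cmod_0; easy.
  - destruct (IH (d / 2)) as [N1 H1]; [lra|]. destruct (Hl a (d / 2)) as [N2 H2]; [lra|].
    exists (Nat.max N1 N2); intros n Hn.
    specialize (H1 n ltac:(lia)); specialize (H2 n ltac:(lia)).
    replace (f n a + csum (f n) L - (g a + csum g L))%C
      with ((f n a - g a) + (csum (f n) L - csum g L))%C by ring.
    eapply Rle_lt_trans; [apply Cmod_triangle|lra]. }
destruct (HN (e / 4) L0) as [N HN']; [lra|].
exists N; intros n Hn. specialize (HN' n Hn).
assert (B1 := has_sum_tail (f n) G (S n) L0 (e / 4) (HS n) (Hf n) H0 Ht).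
assert (B2 := has_sum_tail g G s L0 (e / 4) Hs Hg H0 Ht).
replace (S n - s)%C with ((S n - csum (f n) L0) + ((csum (f n) L0 - csum g L0) +
  - (s - csum g L0)))%C by ring.
eapply Rle_lt_trans; [apply Cmod_triangle|].
eapply Rle_lt_trans; [apply Rplus_le_compat_l, Cmod_triangle|]. rewrite Cmod_opp; lra.
Qed.

Lemma has_sum_fubini {A B} (f : A * B -> C) (g : A -> C) s :
  has_sum f s -> (forall a, has_sum (fun b => f (a, b)) (g a)) -> has_sum g s.
Proof.
intros Hf Hg e He. destruct (Hf (e / 2)) as [L0 H0]; [lra|].
exists (map fst L0); intros L HL Hi.
(* [P] is a union of finite slices over the elements of [L]. Each slice approximates its row sum and
   contains the points of [L0] in that row; the admissible error is halved along [L]. *)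
assert (HP : forall d L, 0 < d -> NoDup L -> exists P, NoDup P /\
   (forall x, In x P -> In (fst x) L) /\
   (forall x, In x L0 -> In (fst x) L -> In x P) /\
   Cmod (csum f P - csum g L)%C <= d).
{ clear - Hg. intros d L Hd HL; revert d Hd; induction HL as [|a L Ha HL IH]; intros d Hd.
  - exists nil; simpl; split; [constructor|]; split; [easy|]; split; [easy|].
    replace (0 - 0)%C with (RtoC 0) by ring. rewrite Cmod_0; lra.
  - destruct (IH (d / 2)) as (P & P1 & P2 & P3 & P4); [lra|].
    destruct (Hg a (d / 2)) as [M0 HM]; [lra|].
    destruct (NoDup_cover (M0 ++ map snd L0)) as (M & HM1 & HM2).
    apply incl_app_inv in HM2 as [HM2 HM3]. specialize (HM M HM1 HM2).
    exists (map (fun b => (a, b)) M ++ P); split; [|split; [|split]].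
    + apply NoDup_app; auto.
      * apply FinFun.Injective_map_NoDup; auto. intros x y E; congruence.
      * intros x Hx Hx'. apply in_map_iff in Hx as (b & <- & Hb).
        apply P2 in Hx'; auto.
    + intros x Hx; apply in_app_or in Hx as [Hx|Hx].
      * apply in_map_iff in Hx as (b & <- & Hb); left; easy.
      * right; auto.
    + intros [x y] Hx [E|Hx']; apply in_or_app.
      * left; apply in_map_iff; exists y; simpl in E; split; [congruence|].
        apply HM3. apply (in_map snd) in Hx; easy.
      * right; auto.
    + rewrite csum_app, csum_map; simpl.
      match goal with |- Cmod (?u + ?v - (?w + ?t))%C <= _ =>
        replace (u + v - (w + t))%C with ((u - w) + (v - t))%C by ring end.
      eapply Rle_trans; [apply Cmod_triangle|lra]. }
destruct (HP (e / 2) L) as (P & P1 & P2 & P3 & P4); [lra|auto|].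
assert (Hi' : incl L0 P).
{ intros x Hx; apply P3; auto. apply Hi, in_map, Hx. }
specialize (H0 P P1 Hi').
replace (csum g L - s)%C with (- (csum f P - csum g L) + (csum f P - s))%C by ring.
eapply Rle_lt_trans; [apply Cmod_triangle|]. rewrite Cmod_opp; lra.
Qed.

(** Slicing a finite set of pairs by the first coordinate bounds its sum by [N] times a finite sum
    of [f]. *)
Lemma summable_prod {A B} (f : A -> R) (g : B -> R) :
  (forall a, 0 <= f a) -> (forall b, 0 <= g b) -> summable f -> summable g ->
  summable (fun x => f (fst x) * g (snd x)).
Proof.
intros Hf Hg [M HM] [N HN].
assert (HN0 : 0 <= N) by (apply (HN nil); constructor).
exists (N * M).
assert (H : forall LA P, NoDup P -> (forall x, In x P -> In (fst x) LA) ->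
   rsum (fun x => f (fst x) * g (snd x)) P <= N * rsum f LA).
{ induction LA as [|a LA IH]; intros P HP Hi.
  - destruct P as [|x P]; [simpl; lra|]. destruct (Hi x); left; easy.
  - set (p := fun x : A * B => if classic_dec (fst x) a then true else false).
    rewrite (rsum_filter _ p); simpl. rewrite Rmult_plus_distr_l.
    apply Rplus_le_compat.
    + assert (E : forall Q : list (A * B), (forall x, In x Q -> fst x = a) ->
        rsum (fun x => f (fst x) * g (snd x)) Q = f a * rsum g (map snd Q)).
      { induction Q as [|x Q IHQ]; intros HQ; simpl; [lra|].
        rewrite IHQ, HQ by (simpl in *; auto). ring. }
      assert (Hp : forall x, In x (filter p P) -> fst x = a).
      { intros x Hx; apply filter_In in Hx as [_ Hx]; unfold p in Hx.
        destruct (classic_dec (fst x) a); easy. }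
      rewrite E by auto. rewrite Rmult_comm; apply Rmult_le_compat_r; auto.
      apply HN. apply NoDup_map_NoDup_ForallPairs; [|apply NoDup_filter; auto].
      intros [x1 x2] [y1 y2] Hx Hy; simpl; apply Hp in Hx; apply Hp in Hy; simpl in *; congruence.
    + apply IH; [apply NoDup_filter; auto|].
      intros x Hx; apply filter_In in Hx as [Hx Hx']; unfold p in Hx'.
      destruct (classic_dec (fst x) a) as [|n]; [easy|].
      destruct (Hi x Hx); [congruence|auto]. }
intros P HP. eapply Rle_trans.
- apply (H (nodup classic_dec (map fst P)) P HP).
  intros x Hx; apply nodup_In, in_map; auto.
- apply Rmult_le_compat_l; auto. apply HM, NoDup_nodup.
Qed.

Lemma has_sum_prod {A B} (f : A -> C) (g : B -> C) s t :
  abs_summable f -> abs_summable g -> has_sum f s -> has_sum g t ->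
  has_sum (fun x => (f (fst x) * g (snd x))%C) (s * t)%C.
Proof.
intros Hf Hg Hs Ht.
destruct (has_sum_exists (fun x => (f (fst x) * g (snd x))%C)) as [r Hr].
{ eapply abs_summable_le; [|apply (summable_prod _ _ (fun a => Cmod_ge_0 (f a))
    (fun b => Cmod_ge_0 (g b)) Hf Hg)].
  intros x; rewrite Cmod_mult; simpl; lra. }
replace (s * t)%C with r; auto.
assert (H := has_sum_fubini _ (fun a => (f a * t)%C) _ Hr
  (fun a => has_sum_scal (f a) g t Ht)).
apply (has_sum_unique _ _ _ H).
rewrite Cmult_comm. apply (has_sum_ext (fun a => (t * f a)%C)); [intros; ring|].
apply has_sum_scal; auto.
Qed.

Lemma has_sum_swap {A B} (f : A * B -> C) (g : A -> C) (h : B -> C) s :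
  abs_summable f -> (forall a, has_sum (fun b => f (a, b)) (g a)) ->
  (forall b, has_sum (fun a => f (a, b)) (h b)) -> has_sum g s -> has_sum h s.
Proof.
intros Hf Hg Hh Hs. destruct (has_sum_exists f Hf) as [r Hr].
assert (E : r = s) by (apply (has_sum_unique g); auto; apply (has_sum_fubini f); auto).
subst r.
apply (has_sum_fubini (fun x : B * A => f (snd x, fst x))); auto.
apply (has_sum_bij (fun x : B * A => (snd x, fst x)) (fun x : A * B => (snd x, fst x)) f); auto;
  intros []; easy.
Qed.

(** Multiplication of Laurent series: the product family is regrouped along the lines where the sum
    [u] of the two indices is constant. *)
Lemma has_sum_cauchy (f g h : Z -> C) s t :
  abs_summable f -> abs_summable g -> has_sum f s -> has_sum g t ->
  (forall u, has_sum (fun l => (f l * g (u - l)%Z)%C) (h u)) -> has_sum h (s * t)%C.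
Proof.
intros Hf Hg Hs Ht Hh.
assert (H := has_sum_prod f g s t Hf Hg Hs Ht).
apply (has_sum_fubini (fun x : Z * Z => (f (snd x) * g (fst x - snd x)%Z)%C)); auto.
apply (has_sum_bij (fun x : Z * Z => (snd x, (fst x - snd x)%Z))
  (fun x => ((fst x + snd x)%Z, fst x)) _ _) in H; auto;
  intros [x y]; simpl; f_equal; lia.
Qed.

Lemma has_sum_split {S1 S2 T} (h1 : S1 -> T) (h2 : S2 -> T) (f : T -> C) :
  (forall x y, h1 x = h1 y -> x = y) -> (forall x y, h2 x = h2 y -> x = y) ->
  (forall x y, h1 x <> h2 y) -> (forall t, (exists x, t = h1 x) \/ (exists y, t = h2 y)) ->
  abs_summable f -> exists s1 s2, has_sum (fun x => f (h1 x)) s1 /\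
    has_sum (fun x => f (h2 x)) s2 /\ has_sum f (s1 + s2)%C.
Proof.
intros I1 I2 D Cv Hf.
set (p := fun t => if excluded_middle_informative (exists x, t = h1 x) then true else false).
assert (Hp1 : forall x, p (h1 x) = true).
{ intros x; unfold p. destruct excluded_middle_informative as [|n]; auto.
  exfalso; apply n; eauto. }
assert (Hp2 : forall x, p (h2 x) = false).
{ intros x; unfold p. destruct excluded_middle_informative as [[y Hy]|]; auto.
  exfalso; apply (D y x); auto. }
set (f1 := fun t => if p t then f t else RtoC 0).
set (f2 := fun t => if p t then RtoC 0 else f t).
assert (Hf1 : abs_summable f1).
{ apply (abs_summable_le f1 (fun t => Cmod (f t))); auto. intros t; unfold f1.
  destruct (p t); [lra|rewrite Cmod_0; apply Cmod_ge_0]. }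
assert (Hf2 : abs_summable f2).
{ apply (abs_summable_le f2 (fun t => Cmod (f t))); auto. intros t; unfold f2.
  destruct (p t); [rewrite Cmod_0; apply Cmod_ge_0|lra]. }
destruct (has_sum_exists f1 Hf1) as [s1 H1]. destruct (has_sum_exists f2 Hf2) as [s2 H2].
exists s1, s2; split; [|split].
- apply (has_sum_ext (fun x => f1 (h1 x))); [intros x; unfold f1; rewrite Hp1; easy|].
  apply has_sum_inj; auto. intros t; unfold f1. destruct (Cv t) as [|[y ->]]; auto.
  rewrite Hp2; auto.
- apply (has_sum_ext (fun x => f2 (h2 x))); [intros x; unfold f2; rewrite Hp2; easy|].
  apply has_sum_inj; auto. intros t; unfold f2. destruct (Cv t) as [[y ->]|]; auto.
  rewrite Hp1; auto.
- apply (has_sum_ext (fun t => (f1 t + f2 t)%C)); [|apply has_sum_plus; auto].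
  intros t; unfold f1, f2; destruct (p t); ring.
Qed.

Lemma has_sum_shift (c : Z) (f : Z -> C) s : has_sum f s -> has_sum (fun k => f (k + c)%Z) s.
Proof.
apply (has_sum_bij (fun k => (k + c)%Z) (fun k => (k - c)%Z)); intros; lia.
Qed.

Lemma has_sum_reflect (c : Z) (f : Z -> C) s : has_sum f s -> has_sum (fun k => f (c - k)%Z) s.
Proof.
apply (has_sum_bij (fun k => (c - k)%Z) (fun k => (c - k)%Z)); intros; lia.
Qed.

Lemma abs_summable_shift (c : Z) (f : Z -> C) :
  abs_summable f -> abs_summable (fun k => f (k + c)%Z).
Proof. apply (abs_summable_inj (fun k => (k + c)%Z)); intros; lia. Qed.

Lemma abs_summable_reflect (c : Z) (f : Z -> C) :
  abs_summable f -> abs_summable (fun k => f (c - k)%Z).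
Proof. apply (abs_summable_inj (fun k => (c - k)%Z)); intros; lia. Qed.

(** * Comparison with two-sided series *)

Lemma norm_C_R (x : C) : norm (x : C_R_NormedModule) = Cmod x.
Proof.
change (sqrt (Rabs (fst x) ^ 2 + Rabs (snd x) ^ 2) = Cmod x).
unfold Cmod; rewrite !pow2_abs; easy.
Qed.

Lemma filterlim_seq_lim (u : nat -> C) (l : C) :
  filterlim u eventually (locally (l : C_R_NormedModule)) <-> seq_lim u l.
Proof.
rewrite (filterlim_locally_ball_norm (K := R_AbsRing) (U := C_R_NormedModule)).
unfold ball_norm; split; intros H.
- intros e He. destruct (H (mkposreal e He)) as [N HN]. exists N; intros n Hn.
  specialize (HN n Hn). rewrite norm_C_R in HN. exact HN.
- intros e. destruct (H e (cond_pos e)) as [N HN]. exists N; intros n Hn.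
  rewrite norm_C_R. exact (HN n Hn).
Qed.

Lemma seq_lim_unique u l l' : seq_lim u l -> seq_lim u l' -> l = l'.
Proof.
intros H H'; apply Cmod_eq_of_small; intros e He.
destruct (H (e / 2)) as [N HN]; [lra|]. destruct (H' (e / 2)) as [N' HN']; [lra|].
specialize (HN (N + N')%nat ltac:(lia)); specialize (HN' (N + N')%nat ltac:(lia)).
replace (l - l')%C with (- (u (N + N')%nat - l) + (u (N + N')%nat - l'))%C by ring.
eapply Rle_trans; [apply Cmod_triangle|]. rewrite Cmod_opp; lra.
Qed.

Lemma sum_n_csum (f : nat -> C) n :
  sum_n (G := C_R_NormedModule) f n = csum f (seq 0 (S n)).
Proof.
induction n as [|n IH].
- rewrite sum_O; simpl; ring.
- rewrite sum_Sn, IH, (seq_S (S n)), csum_app; simpl.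
  change plus with Cplus. ring.
Qed.

Lemma has_sum_series (f : nat -> C) s :
  has_sum f s -> is_series (V := C_R_NormedModule) f s.
Proof.
intros H. apply filterlim_seq_lim. intros e He. destruct (H e He) as [L0 H0].
exists (list_max L0). intros n Hn. rewrite sum_n_csum. apply H0; [apply seq_NoDup|].
intros x Hx. apply in_seq. assert (x <= list_max L0)%nat; [|lia].
assert (F := proj1 (list_max_le L0 (list_max L0)) (le_n _)).
rewrite Forall_forall in F; auto.
Qed.

Lemma is_Zsum_unique (f : Z -> C) s t : is_Zsum f s -> is_Zsum f t -> s = t.
Proof.
intros (s1 & s2 & H1 & H2 & ->) (t1 & t2 & H3 & H4 & ->).
apply filterlim_seq_lim in H1, H2, H3, H4.
f_equal; eapply seq_lim_unique; eauto.
Qed.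

(** Both notions determine their value, so one value [t] that is a sum in both senses suffices. *)
Lemma is_Zsum_has_sum (f : Z -> C) s : abs_summable f -> is_Zsum f s <-> has_sum f s.
Proof.
intros Hf.
assert (H : exists t, has_sum f t /\ is_Zsum f t).
{ destruct (has_sum_split Z.of_nat (fun n => (- Z.of_nat (S n))%Z) f)
    as (s1 & s2 & H1 & H2 & H3); auto; try (intros; lia).
  - intros t; destruct (Z_le_gt_dec 0 t); [left; exists (Z.to_nat t)|
      right; exists (Z.to_nat (- t - 1))]; lia.
  - exists (s1 + s2)%C; split; auto. exists s1, s2; split; [|split]; auto; apply has_sum_series; auto. }
destruct H as (t & H1 & H2); split; intros H.
- rewrite (is_Zsum_unique f s t); auto.
- rewrite (has_sum_unique f s t); auto.
Qed.

Lemma Zsum_eq (f : Z -> C) s : abs_summable f -> has_sum f s -> Zsum f = s.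
Proof.
intros Hf Hs. apply is_Zsum_has_sum in Hs; auto.
apply (iota_unique (V := C_R_CompleteNormedModule)); auto.
intros y Hy; apply (is_Zsum_unique f); auto.
Qed.

Lemma has_sum_Zsum (f : Z -> C) : abs_summable f -> has_sum f (Zsum f).
Proof.
intros Hf. destruct (has_sum_exists f Hf) as [s Hs]. rewrite (Zsum_eq f s); auto.
Qed.

(** * Absolutely convergent sums of exponentials *)

Lemma rsum_geom (x : R) n : x <> 1 -> rsum (fun k => x ^ k) (seq 0 n) = (1 - x ^ n) / (1 - x).
Proof.
intros Hx; induction n as [|n IH]; [simpl; field; lra|].
rewrite seq_S, rsum_app, IH; simpl; field; lra.
Qed.

Lemma exp_mult_INR (a : R) n : exp (a * INR n) = exp a ^ n.
Proof.
induction n as [|n IH]; [simpl; rewrite Rmult_0_r; apply exp_0|].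
rewrite S_INR, Rmult_plus_distr_l, exp_plus, IH, Rmult_1_r; simpl; ring.
Qed.

Lemma exp_le_mono x y : x <= y -> exp x <= exp y.
Proof. intros [H| ->]; [left; apply exp_increasing; auto|lra]. Qed.

(** Two geometric series dominate; the index 0 is counted in both, which is harmless for an upper
    bound. *)
Lemma summable_exp_abs (d : R) : 0 < d -> summable (fun k : Z => exp (- (d * Rabs (IZR k)))).
Proof.
intros Hd. set (x := exp (- d)).
assert (Hx : 0 < x < 1).
{ split; [apply exp_pos|]. unfold x; rewrite <- exp_0; apply exp_increasing; lra. }
exists (2 * (1 / (1 - x))). intros L HL.
set (n := S (list_max (map Z.abs_nat L))).
apply Rle_trans with (rsum (fun k : Z => exp (- (d * Rabs (IZR k))))
  (map Z.of_nat (seq 0 n) ++ map (fun m => (- Z.of_nat m)%Z) (seq 0 n))).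
- apply rsum_incl; auto; [intros; left; apply exp_pos|].
  intros k Hk.
  assert (Hn : (Z.abs_nat k <= list_max (map Z.abs_nat L))%nat).
  { assert (F := proj1 (list_max_le (map Z.abs_nat L) _) (le_n _)).
    rewrite Forall_forall in F. apply F, in_map, Hk. }
  assert (Hs : In (Z.abs_nat k) (seq 0 n)) by (apply in_seq; unfold n; clear - Hn; lia).
  assert (Ek := Zabs2Nat.id_abs k).
  apply in_or_app. destruct (Z_le_gt_dec 0 k); [left|right]; apply in_map_iff;
    exists (Z.abs_nat k); (split; [rewrite Ek; clear Hn; lia|exact Hs]).
- assert (E : forall m, exp (- (d * Rabs (IZR (Z.of_nat m)))) = x ^ m).
  { intros m. unfold x; rewrite <- exp_mult_INR, <- INR_IZR_INZ, Rabs_pos_eq by apply pos_INR.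
    f_equal; ring. }
  assert (B : rsum (fun m => x ^ m) (seq 0 n) <= 1 / (1 - x)).
  { rewrite rsum_geom by lra. apply Rmult_le_compat_r.
    - left; apply Rinv_0_lt_compat; lra.
    - assert (0 < x ^ n) by (apply pow_lt; lra). lra. }
  rewrite rsum_app, !rsum_map.
  assert (E1 := functional_extensionality _ _ E). rewrite E1.
  assert (E2 : (fun m => exp (- (d * Rabs (IZR (- Z.of_nat m))))) = (fun m => x ^ m)).
  { apply functional_extensionality; intros m. rewrite opp_IZR, Rabs_Ropp; auto. }
  rewrite E2, <- Rplus_diag; apply Rplus_le_compat; exact B.
Qed.

Lemma summable_gauss (a b c K : R) (f : Z -> R) : 0 < a -> 0 <= K ->
  (forall k, f k <= K * exp (c * Rabs (IZR k) + b * IZR k - a * IZR k ^ 2)) -> summable f.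
Proof.
(* The summand 1 in [g] leaves the factor [exp (- |k|)] once the square is completed. *)
intros Ha HK Hf. set (g := Rabs b + Rabs c + 1).
apply summable_le with (fun k => (K * exp (g ^ 2 / (4 * a))) * exp (- (1 * Rabs (IZR k)))).
- intros k. eapply Rle_trans; [apply Hf|].
  rewrite Rmult_assoc, <- exp_plus. apply Rmult_le_compat_l; auto.
  apply exp_le_mono. set (x := Rabs (IZR k)).
  assert (H1 : IZR k ^ 2 = x ^ 2) by (unfold x; symmetry; apply pow2_abs).
  assert (Hx : 0 <= x) by apply Rabs_pos.
  assert (H2 : b * IZR k <= Rabs b * x).
  { unfold x; rewrite <- Rabs_mult; apply Rle_abs. }
  assert (H3 : c * x <= Rabs c * x) by (apply Rmult_le_compat_r; [auto|apply Rle_abs]).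
  assert (H4 : g * x - a * x ^ 2 <= g ^ 2 / (4 * a)).
  { apply Rmult_le_reg_l with (4 * a); [lra|].
    replace (4 * a * (g ^ 2 / (4 * a))) with (g ^ 2) by (field; lra).
    assert (0 <= (g - 2 * a * x) ^ 2) by apply pow2_ge_0. nra. }
  rewrite H1. unfold g in H4 at 1. lra.
- apply summable_scal; [|apply summable_exp_abs; lra].
  apply Rmult_le_pos; auto. left; apply exp_pos.
Qed.

(** * Rules for exponentials and signs *)

Lemma Cexp_plus x y : Cexp (x + y)%C = (Cexp x * Cexp y)%C.
Proof.
destruct x as [a b], y as [c d]. unfold Cexp; simpl.
rewrite exp_plus, cos_plus, sin_plus. unfold Cmult, Cplus; simpl. f_equal; ring.
Qed.

Lemma epow_plus u a b : epow u (a + b) = (epow u a * epow u b)%C.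
Proof. unfold epow; rewrite <- Cexp_plus, RtoC_plus; f_equal; ring. Qed.

Lemma epow_add u v a : epow (u + v)%C a = (epow u a * epow v a)%C.
Proof. unfold epow; rewrite <- Cexp_plus; f_equal; ring. Qed.

Lemma epow_scal c u a : epow (RtoC c * u)%C a = epow u (c * a).
Proof. unfold epow; rewrite (RtoC_mult c a); f_equal; ring. Qed.

Lemma Cmod_epow u a : Cmod (epow u a) = exp (- (2 * PI * Im u * a)).
Proof.
unfold epow, Cexp. destruct u as [x y].
unfold Cmod; simpl fst; simpl snd.
match goal with |- sqrt ((?e * ?c) ^ 2 + (?e * ?s) ^ 2) = _ =>
  replace ((e * c) ^ 2 + (e * s) ^ 2) with (e ^ 2 * (s ^ 2 + c ^ 2)) by ring end.
rewrite <- !Rsqr_pow2, sin2_cos2, Rmult_1_r, sqrt_Rsqr by (left; apply exp_pos).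
f_equal; simpl; ring.
Qed.

Lemma epow_neq_0 u a : epow u a <> RtoC 0.
Proof. apply Cmod_gt_0; rewrite Cmod_epow; apply exp_pos. Qed.

Lemma epow_0 u : epow u 0 = RtoC 1.
Proof.
assert (H := epow_plus u 0 0). rewrite Rplus_0_l in H.
assert (N := epow_neq_0 u 0).
transitivity (epow u 0 * epow u 0 / epow u 0)%C; [|rewrite <- H]; field; auto.
Qed.

Lemma epow_opp u a : epow u (- a) = (/ epow u a)%C.
Proof.
assert (N := epow_neq_0 u a).
transitivity ((epow u (- a) * epow u a) / epow u a)%C; [field; auto|].
rewrite <- epow_plus. replace (- a + a) with 0 by ring. rewrite epow_0; field; auto.
Qed.

(** This makes a sign an exponential in [u = 1], so that [sgn] inherits the rules of [epow]. *)
Lemma epow_1_half : epow 1 (1 / 2) = RtoC (-1).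
Proof.
unfold epow, Cexp.
replace (RtoC (2 * PI) * Ci * RtoC (1 / 2) * 1)%C with (0, PI).
- simpl. rewrite exp_0, cos_PI, sin_PI. unfold RtoC; f_equal; ring.
- unfold RtoC, Ci, Cmult; simpl; f_equal; field.
Qed.

Lemma Cpow_epow u a k : Cpow (epow u a) k = epow u (a * INR k).
Proof.
induction k as [|k IH]; [simpl; rewrite Rmult_0_r, epow_0; easy|].
rewrite S_INR, Rmult_plus_distr_l, epow_plus, Rmult_1_r. simpl; rewrite IH; ring.
Qed.

Lemma Cpowz_epow u a n : Cpowz (epow u a) n = epow u (a * IZR n).
Proof.
destruct n as [|k|k]; simpl.
- rewrite Rmult_0_r, epow_0; easy.
- rewrite Cpow_epow, INR_IZR_INZ, positive_nat_Z; easy.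
- rewrite Cpow_epow, INR_IZR_INZ, positive_nat_Z, <- epow_opp.
  f_equal. change (Z.neg k) with (- Z.pos k)%Z. rewrite opp_IZR; ring.
Qed.

Lemma Cpowz_mult x y n : x <> RtoC 0 -> y <> RtoC 0 ->
  Cpowz (x * y)%C n = (Cpowz x n * Cpowz y n)%C.
Proof.
intros Hx Hy.
assert (H : forall k, Cpow (x * y)%C k = (Cpow x k * Cpow y k)%C).
{ induction k as [|k IH]; simpl; [|rewrite IH]; ring. }
destruct n as [|k|k]; simpl; [ring|auto|]. rewrite H. field.
split; apply Cpow_nz; auto.
Qed.

Definition sgn (n : Z) : C := Cpowz (RtoC (-1)) n.

Lemma sgn_epow n : sgn n = epow 1 (IZR n / 2).
Proof. unfold sgn. rewrite <- epow_1_half, Cpowz_epow; f_equal; field. Qed.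

Lemma sgn_0 : sgn 0 = RtoC 1.
Proof. easy. Qed.

Lemma sgn_1 : sgn 1 = (- (1))%C.
Proof. apply injective_projections; simpl; ring. Qed.

Lemma sgn_add a b : sgn (a + b) = (sgn a * sgn b)%C.
Proof. rewrite !sgn_epow, <- epow_plus, plus_IZR; f_equal; field. Qed.

Lemma RtoC_m1_neq_0 : RtoC (-1) <> RtoC 0.
Proof. intros H; apply RtoC_inj in H; lra. Qed.

Lemma sgn_sqr n : (sgn n * sgn n)%C = RtoC 1.
Proof.
unfold sgn; rewrite <- Cpowz_mult by apply RtoC_m1_neq_0.
replace (RtoC (-1) * RtoC (-1))%C with (epow 1 0).
- rewrite Cpowz_epow, Rmult_0_l; apply epow_0.
- rewrite epow_0, <- RtoC_mult; f_equal; ring.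
Qed.

Lemma Cmod_sgn n : Cmod (sgn n) = 1.
Proof.
rewrite sgn_epow, Cmod_epow; simpl. rewrite <- exp_0; f_equal; ring.
Qed.

Lemma sgn_even a b k : (a - b = 2 * k)%Z -> sgn a = sgn b.
Proof.
intros E; replace a with (b + (k + k))%Z by lia.
rewrite !sgn_add, sgn_sqr; ring.
Qed.

Lemma sgn_odd a b k : (a - b = 2 * k + 1)%Z -> sgn a = (- sgn b)%C.
Proof.
intros E; replace a with (b + 1 + (k + k))%Z by lia.
rewrite !sgn_add, sgn_sqr, sgn_1; ring.
Qed.

(** Doubling removes the division; in this form [lia] can check identities between exponents. *)
Lemma binom2_spec n : (2 * binom2 n = n * (n - 1))%Z.
Proof.
unfold binom2. symmetry. apply Z_div_exact_full_2; [lia|].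
assert (E := Z.mod_pos_bound n 2).
rewrite Zmult_mod, Zminus_mod.
assert (H : (n mod 2 = 0 \/ n mod 2 = 1)%Z) by lia.
destruct H as [-> | ->]; easy.
Qed.

(** * Coefficients of the reciprocal theta function *)

Section QSeries.

Context (tau : C) (tau_pos : 0 < Im tau).

(** The signed power [(-1)^s q^e]. With integers [s] and [e], an identity between such terms reduces
    to a parity and an equality in Z. *)
Definition mono (s e : Z) : C := (sgn s * epow tau (IZR e))%C.

(** Chosen so that [|q| = exp (- decay)]. *)
Definition decay : R := 2 * PI * Im tau.

Lemma decay_pos : 0 < decay.
Proof. unfold decay. assert (H := PI_RGT_0). apply Rmult_lt_0_compat; lra. Qed.

Lemma mono_mul s e s' e' : (mono s e * mono s' e')%C = mono (s + s') (e + e').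
Proof. unfold mono. rewrite sgn_add, plus_IZR, epow_plus; ring. Qed.

Lemma mono_eq s e s' e' k : (s - s' = 2 * k)%Z -> e = e' -> mono s e = mono s' e'.
Proof. intros H ->; unfold mono; rewrite (sgn_even s s' k); easy. Qed.

Lemma mono_opp s e s' e' k : (s - s' = 2 * k + 1)%Z -> e = e' -> mono s e = (- mono s' e')%C.
Proof. intros H ->; unfold mono; rewrite (sgn_odd s s' k) by auto; ring. Qed.

Lemma mono_0 : mono 0 0 = RtoC 1.
Proof. unfold mono; rewrite sgn_0, epow_0; ring. Qed.

Lemma Cmod_mono s e : Cmod (mono s e) = exp (- (decay * IZR e)).
Proof. unfold mono, decay. rewrite Cmod_mult, Cmod_sgn, Cmod_epow; ring. Qed.

Lemma mono_neq_0 s e : mono s e <> RtoC 0.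
Proof. apply Cmod_gt_0; rewrite Cmod_mono; apply exp_pos. Qed.

Lemma mono_neq_1 e : e <> 0%Z -> mono 0 e <> RtoC 1.
Proof.
intros He H. apply (f_equal Cmod) in H. rewrite Cmod_mono, Cmod_1, <- exp_0 in H.
apply exp_inv in H. assert (Hd := decay_pos).
assert (IZR e <> 0) by (apply not_0_IZR; auto).
assert (decay * IZR e = 0) by lra. apply Rmult_integral in H1; lra.
Qed.

(** The factor [exp (g |k|)] leaves room for the weights met below: powers [z^k], and a factor [k],
    which is at most [exp |k|]. *)
Lemma abs_summable_quad (f : Z -> C) (e : Z -> Z) (a b c : Z) (g K : R) :
  (0 < a)%Z -> 0 <= K -> (forall k, 2 * e k = a * (k * k) + b * k + c)%Z ->
  (forall k, Cmod (f k) <= K * exp (g * Rabs (IZR k)) * Cmod (mono 0 (e k))) ->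
  abs_summable f.
Proof.
intros Ha HK He Hf. assert (Hd := decay_pos). apply IZR_lt in Ha.
apply (summable_gauss (decay * IZR a / 2) (- (decay * IZR b / 2)) g
   (K * exp (- (decay * IZR c / 2)))).
- assert (0 < decay * IZR a) by (apply Rmult_lt_0_compat; auto). lra.
- apply Rmult_le_pos; auto; left; apply exp_pos.
- intros k. eapply Rle_trans; [apply Hf|]. right.
  rewrite Cmod_mono, !Rmult_assoc, <- !exp_plus. do 2 f_equal.
  assert (E := f_equal IZR (He k)). rewrite !plus_IZR, !mult_IZR in E.
  replace (IZR (e k)) with ((IZR a * (IZR k * IZR k) + IZR b * IZR k + IZR c) / 2) by lra.
  field.
Qed.

Lemma abs_summable_mono (s e : Z -> Z) (a b c : Z) :
  (0 < a)%Z -> (forall k, 2 * e k = a * (k * k) + b * k + c)%Z ->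
  abs_summable (fun k => mono (s k) (e k)).
Proof.
intros Ha He. apply (abs_summable_quad _ e a b c 0 1); auto; [lra|].
intros k. rewrite !Cmod_mono, Rmult_0_l, exp_0; lra.
Qed.

(** Coefficient of [z^l] in [j(z; q)]. *)
Definition tcoef (l : Z) : C := mono l (binom2 l).

Lemma tcoef_summable : abs_summable tcoef.
Proof.
apply (abs_summable_mono (fun l => l) binom2 1 (-1) 0); [lia|].
intros k. assert (H := binom2_spec k); lia.
Qed.

(** This is [j(1; q) = 0]: the reflection [l -> 1 - l] keeps the exponent and changes the sign. *)
Lemma tcoef_sum : has_sum tcoef (RtoC 0).
Proof.
destruct (has_sum_exists _ tcoef_summable) as [s Hs].
assert (H := has_sum_reflect 1 _ _ Hs).
assert (H' : has_sum tcoef (- s)%C).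
{ apply has_sum_opp in H. revert H; apply has_sum_ext. intros l; unfold tcoef.
  symmetry; apply (mono_opp _ _ _ _ (l - 1)); [lia|].
  assert (H1 := binom2_spec l); assert (H2 := binom2_spec (1 - l)); lia. }
assert (E := has_sum_unique _ _ _ Hs H').
replace (RtoC 0) with s; auto.
replace s with ((s + s) / 2)%C by field.
rewrite E at 2. field.
Qed.

(** Coefficients of [1 / j(z; q)] up to a constant, on [|q| < |z| < 1]: expand
    the partial fractions [sum_n (-1)^n q^(n(n+1)/2) / (1 - z q^n)]. *)
Definition rterm (a n : Z) : C :=
  if (0 <=? n)%Z then mono n (binom2 (n + 1) + a * n) else RtoC 0.

(** The number [A_a] of the overview. Its terms are extended by 0 to negative [n] so that shifts and
    reflections of Z apply. *)
Definition rcoef (a : Z) : C := Zsum (rterm a).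

Lemma rterm_full_summable a : abs_summable (fun n => mono n (binom2 (n + 1) + a * n)).
Proof.
apply (abs_summable_mono (fun n => n) _ 1 (1 + 2 * a) 0); [lia|].
intros k. assert (H := binom2_spec (k + 1)); lia.
Qed.

Lemma rterm_summable a : abs_summable (rterm a).
Proof.
apply (abs_summable_le _ (fun n => Cmod (mono n (binom2 (n + 1) + a * n))));
  [|apply rterm_full_summable].
intros n; unfold rterm; destruct (0 <=? n)%Z; [lra|]. rewrite Cmod_0; apply Cmod_ge_0.
Qed.

Lemma rcoef_sum a : has_sum (rterm a) (rcoef a).
Proof. apply has_sum_Zsum, rterm_summable. Qed.

(** Shifting [n] by one turns the terms [n >= 1] of [A_a] into those of [- q^(a+1) A_(a+1)]. The
    initial term 1 then sits at [n = -1]. *)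
Lemma rcoef_succ a : (rcoef a + mono 0 (a + 1) * rcoef (a + 1))%C = RtoC 1.
Proof.
assert (H := has_sum_shift 1 _ _ (rcoef_sum a)).
assert (H1 : has_sum (fun n => if (n =? -1)%Z then RtoC 1 else RtoC 0) (RtoC 1)).
{ apply (has_sum_single (fun n => if (n =? -1)%Z then RtoC 1 else RtoC 0) (-1)%Z).
  intros x Hx. apply Z.eqb_neq in Hx; rewrite Hx; easy. }
assert (H2 := has_sum_scal (mono 0 (a + 1)) _ _ (rcoef_sum (a + 1))).
assert (E : rcoef a = (1 - mono 0 (a + 1) * rcoef (a + 1))%C).
{ apply (has_sum_unique _ _ _ H). generalize (has_sum_minus _ _ _ _ H1 H2).
  apply has_sum_ext. intros n. unfold rterm.
  assert (B1 := binom2_spec (n + 1)). assert (B2 := binom2_spec (n + 1 + 1)).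
  destruct (Z.eqb_spec n (-1)) as [->|Hn]; simpl.
  - rewrite Z.mul_0_r; change (binom2 1 + 0)%Z with 0%Z. rewrite mono_0; ring.
  - destruct (Z.leb_spec 0 n); destruct (Z.leb_spec 0 (n + 1)); try lia; [|ring].
    rewrite mono_mul, (mono_opp (n + 1) _ (0 + n) (a + 1 + (binom2 (n + 1) + (a + 1) * n)) 0);
      [ring|lia|lia]. }
rewrite E; ring.
Qed.

(** The same series taken over all of Z vanishes, by the reflection [n -> -1 - 2 a - n]. Hence the
    half [n >= 0] is minus the half [n < 0], and [n -> -1 - n] identifies the latter with a multiple
    of [A_(-a)]. *)
Lemma rcoef_opp a : rcoef a = (mono 0 (- a) * rcoef (- a))%C.
Proof.
destruct (has_sum_exists _ (rterm_full_summable a)) as [s Hs].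
assert (E0 : s = RtoC 0).
{ assert (H := has_sum_opp _ _ (has_sum_reflect (- 1 - 2 * a) _ _ Hs)).
  assert (E : s = (- s)%C).
  { apply (has_sum_unique _ _ _ Hs). revert H; apply has_sum_ext; intros n.
    symmetry; apply (mono_opp _ _ _ _ (n + a)); [lia|].
    assert (B1 := binom2_spec (n + 1)). assert (B2 := binom2_spec (-1 - 2 * a - n + 1)). lia. }
  replace s with ((s + s) / 2)%C by field.
  rewrite E at 2. field. }
assert (H := has_sum_minus _ _ _ _ Hs (rcoef_sum a)).
assert (H1 := has_sum_opp _ _ (has_sum_reflect (-1) _ _ H)).
assert (H2 := has_sum_scal (mono 0 (- a)) _ _ (rcoef_sum (- a))).
replace (rcoef a) with (- (s - rcoef a))%C by (rewrite E0; ring).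
apply (has_sum_unique _ _ _ H1). revert H2; apply has_sum_ext; intros n.
unfold rterm.
assert (B1 := binom2_spec (n + 1)). assert (B2 := binom2_spec (-1 - n + 1)).
destruct (Z.leb_spec 0 n); destruct (Z.leb_spec 0 (-1 - n)); try lia; [|ring].
rewrite mono_mul, (mono_opp (-1 - n) _ (0 + n) (- a + (binom2 (n + 1) + - a * n)) (- n - 1));
  [ring|lia|lia].
Qed.

(** For [a >= 0] the terms are dominated by those of [A_0]. For [a < 0] the relation
    [A_a = q^(-a) A_(-a)] adds the decay [|q|^(-a)]. *)
Lemma rcoef_bound : exists K, 0 <= K /\
  forall a, Cmod (rcoef a) <= K /\ Cmod (rcoef a) <= K * exp (decay * IZR a).
Proof.
destruct (rterm_summable 0) as [K HK]. exists K.
assert (Hd := decay_pos).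
assert (K0 : 0 <= K) by (apply (HK nil); constructor).
assert (H : forall a, (0 <= a)%Z -> Cmod (rcoef a) <= K).
{ intros a Ha. apply (has_sum_bound _ _ _ (rcoef_sum a)). intros L HL.
  eapply Rle_trans; [|apply (HK L HL)]. apply rsum_le; intros n. unfold rterm.
  destruct (Z.leb_spec 0 n); [|lra]. rewrite !Cmod_mono. apply exp_le_mono.
  apply Ropp_le_contravar, Rmult_le_compat_l; [lra|]. apply IZR_le. nia. }
split; auto. intros a. destruct (Z_le_gt_dec 0 a) as [Ha|Ha].
- split; auto. apply Rle_trans with (K * 1); [rewrite Rmult_1_r; auto|].
  apply Rmult_le_compat_l; auto. rewrite <- exp_0; apply exp_le_mono.
  apply Rmult_le_pos; [lra|apply IZR_le; auto].
- assert (Ha' : IZR a < 0) by (apply IZR_lt; lia).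
  assert (H1 := H (- a)%Z ltac:(lia)).
  assert (E : Cmod (rcoef a) = exp (decay * IZR a) * Cmod (rcoef (- a))).
  { rewrite rcoef_opp, Cmod_mult, Cmod_mono, opp_IZR; do 2 f_equal; ring. }
  assert (He : exp (decay * IZR a) <= 1).
  { rewrite <- exp_0; apply exp_le_mono; nra. }
  assert (Hp := exp_pos (decay * IZR a)).
  assert (Hc := Cmod_ge_0 (rcoef (- a))).
  rewrite E; split; [|rewrite Rmult_comm; apply Rmult_le_compat_r; lra].
  apply Rle_trans with (1 * K); [apply Rmult_le_compat; lra|lra].
Qed.

Lemma conv_summable u : abs_summable (fun l => (tcoef l * rcoef (u - l))%C).
Proof.
destruct rcoef_bound as (K & HK & H).
apply (abs_summable_le _ (fun l => K * Cmod (tcoef l))).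
- intros l. rewrite Cmod_mult, Rmult_comm. apply Rmult_le_compat_r; [apply Cmod_ge_0|apply H].
- apply summable_scal; auto. apply tcoef_summable.
Qed.

(** Constant term of the product of the two expansions; [kappa_qpoch] identifies it with [(q)^3]. *)
Definition kappa : C := Zsum (fun l => (tcoef l * rcoef (0 - l))%C).

Lemma tcoef_succ l : tcoef (l + 1) = (- mono l (binom2 l + l))%C.
Proof.
apply (mono_opp _ _ _ _ 0); [lia|].
assert (B1 := binom2_spec l). assert (B2 := binom2_spec (l + 1)). lia.
Qed.

(** The convolution [g] satisfies [q^u g_u = g_u], so it vanishes off [u = 0]. *)
Lemma conv_sum u :
  has_sum (fun l => (tcoef l * rcoef (u - l))%C) (if (u =? 0)%Z then kappa else RtoC 0).
Proof.
destruct (Z.eqb_spec u 0) as [->|Hu]; [apply has_sum_Zsum, conv_summable|].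
destruct (has_sum_exists _ (conv_summable u)) as [g Hg].
assert (E : (mono 0 u * g)%C = g).
{ apply (has_sum_unique _ _ _ (has_sum_scal (mono 0 u) _ _ Hg)).
  (* Subtracting the null series [tcoef_sum] replaces [A] by [A - 1], which the recurrence turns
     into a multiple of the next [A]. *)
  assert (H := has_sum_minus _ _ _ _ (has_sum_shift 1 _ _ Hg) (has_sum_shift 1 _ _ tcoef_sum)).
  replace (g - 0)%C with g in H by ring.
  revert H; apply has_sum_ext; intros l.
  assert (R := rcoef_succ (u - (l + 1))). replace (u - (l + 1) + 1)%Z with (u - l)%Z in R by lia.
  transitivity (tcoef (l + 1) * (rcoef (u - (l + 1)) - 1))%C; [ring|].
  rewrite <- R, tcoef_succ. unfold tcoef.
  transitivity (mono l (binom2 l + l) * mono 0 (u - l) * rcoef (u - l))%C; [ring|].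
  rewrite Cmult_assoc, !mono_mul. f_equal. apply (mono_eq _ _ _ _ 0); lia. }
replace (RtoC 0) with g; auto.
assert (N := mono_neq_1 u Hu).
assert (N' : (mono 0 u - 1)%C <> RtoC 0).
{ intros H; apply N. replace (mono 0 u) with ((mono 0 u - 1) + 1)%C by ring. rewrite H; ring. }
transitivity ((mono 0 u * g - g) / (mono 0 u - 1))%C; [field; auto|].
rewrite E; field; auto.
Qed.

Lemma Rabs_le_exp x : Rabs x <= exp (1 * Rabs x).
Proof.
rewrite Rmult_1_l. assert (H := exp_ineq1_le (Rabs x)). lra.
Qed.

Lemma tcoef_weighted_summable : abs_summable (fun l => (RtoC (IZR l) * tcoef l)%C).
Proof.
apply (abs_summable_quad _ binom2 1 (-1) 0 1 1); [lia|lra| |].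
- intros k. assert (H := binom2_spec k); lia.
- intros k. rewrite Cmod_mult, Cmod_R. unfold tcoef. rewrite !Cmod_mono, Rmult_1_l.
  apply Rmult_le_compat_r; [left; apply exp_pos|apply Rabs_le_exp].
Qed.

(** Summation by parts: [tcoef l] is the increment of [l |-> tcoef l * rcoef (- l)]. *)
Lemma kappa_tcoef : has_sum (fun l => (RtoC (IZR l) * tcoef l)%C) (- kappa)%C.
Proof.
set (r := fun l => (tcoef l * rcoef (0 - l))%C).
assert (Hr : has_sum r kappa) by apply (conv_sum 0).
assert (D : forall l, (r l - r (l + -1)%Z)%C = tcoef l).
{ intros l; unfold r.
  assert (R := rcoef_succ (0 - l)). replace (0 - l + 1)%Z with (0 - (l + -1))%Z in R by lia.
  assert (S := tcoef_succ (l + -1)). replace (l + -1 + 1)%Z with l in S by lia.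
  rewrite S.
  transitivity (- mono (l + -1) (binom2 (l + -1) + (l + -1)) *
    (rcoef (0 - l) + mono 0 (0 - (l + -1)) * rcoef (0 - (l + -1))))%C;
    [|rewrite R; ring].
  replace (tcoef (l + -1)) with (mono (l + -1) (binom2 (l + -1) + (l + -1)) *
    mono 0 (0 - (l + -1)))%C; [ring|].
  rewrite mono_mul; apply (mono_eq _ _ _ _ 0); lia. }
destruct rcoef_bound as (K & HK & HR).
assert (HG : abs_summable (fun l => (RtoC (IZR l) * r l)%C)).
{ apply (abs_summable_le _ (fun l => K * Cmod (RtoC (IZR l) * tcoef l)%C)).
  - intros l; unfold r. rewrite Cmult_assoc, Cmod_mult, Rmult_comm.
    apply Rmult_le_compat_r; [apply Cmod_ge_0|apply HR].
  - apply summable_scal; auto. apply tcoef_weighted_summable. }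
destruct (has_sum_exists _ HG) as [G HGs].
(* With [t_l = r_l - r_(l-1)], one has [l t_l = l r_l - (l-1) r_(l-1) - r_l + t_l]; the first two
   terms contribute [G - G]. *)
assert (H := has_sum_plus _ _ _ _ (has_sum_minus _ _ _ _ (has_sum_minus _ _ _ _ HGs
  (has_sum_shift (-1) _ _ HGs)) Hr) tcoef_sum).
replace (G - G - kappa + 0)%C with (- kappa)%C in H by ring.
revert H; apply has_sum_ext; intros l. rewrite <- D, plus_IZR, RtoC_plus.
replace (IZR (-1)) with (- (1)) by ring. rewrite RtoC_opp. ring.
Qed.

End QSeries.

(** * Jacobi's identity *)

Lemma seq_lim_const l : seq_lim (fun _ => l) l.
Proof.
intros e He; exists O; intros n _. replace (l - l)%C with (RtoC 0) by ring.
rewrite Cmod_0; auto.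
Qed.

Lemma seq_lim_mult u v l m : seq_lim u l -> seq_lim v m ->
  seq_lim (fun n => (u n * v n)%C) (l * m)%C.
Proof.
intros Hu Hv e He. set (K := Cmod l + Cmod m + 1).
assert (H1 := Cmod_ge_0 l). assert (H2 := Cmod_ge_0 m).
assert (HK : 0 < K) by (unfold K; lra).
set (d := Rmin 1 (e / (2 * K))).
assert (Hd : 0 < d) by (apply Rmin_pos; [lra|apply Rdiv_lt_0_compat; lra]).
destruct (Hu d Hd) as [N1 A1]. destruct (Hv d Hd) as [N2 A2].
exists (N1 + N2)%nat; intros n Hn.
specialize (A1 n ltac:(lia)); specialize (A2 n ltac:(lia)).
replace (u n * v n - l * m)%C with ((u n - l) * (v n - m) + (l * (v n - m) + (u n - l) * m))%C
  by ring.
eapply Rle_lt_trans; [apply Cmod_triangle|].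
eapply Rle_lt_trans; [apply Rplus_le_compat_l, Cmod_triangle|].
rewrite !Cmod_mult.
assert (B1 := Cmod_ge_0 (u n - l)%C). assert (B2 := Cmod_ge_0 (v n - m)%C).
assert (D1 : d <= 1) by apply Rmin_l.
assert (D2 : d * K <= e / 2).
{ replace (e / 2) with (e / (2 * K) * K) by (field; lra).
  apply Rmult_le_compat_r; [lra|apply Rmin_r]. }
unfold K in *. nra.
Qed.

(** The bound on the inverses keeps the sequence away from 0. For the q-factorials this yields that
    [(q)_inf] is not 0. *)
Lemma seq_lim_inv u l B : (forall n, u n <> RtoC 0) -> (forall n, Cmod (/ u n)%C <= B) ->
  seq_lim u l -> l <> RtoC 0 /\ seq_lim (fun n => (/ u n)%C) (/ l)%C.
Proof.
intros Hu HB Hl.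
assert (HB0 : 0 < B).
{ apply Rlt_le_trans with (Cmod (/ u O)%C); auto. rewrite Cmod_inv by auto.
  apply Rinv_0_lt_compat, Cmod_gt_0; auto. }
assert (Hl0 : l <> RtoC 0).
{ intros ->. destruct (Hl (/ B)) as [N HN]; [apply Rinv_0_lt_compat; auto|].
  specialize (HN N (le_n _)). replace (u N - 0)%C with (u N) in HN by ring.
  specialize (HB N). rewrite Cmod_inv in HB by auto.
  assert (P : 0 < Cmod (u N)) by (apply Cmod_gt_0; auto).
  apply Rinv_lt_contravar in HN; [rewrite Rinv_inv in HN; lra|].
  apply Rmult_lt_0_compat; auto. apply Rinv_0_lt_compat; auto. }
split; auto. intros e He.
assert (P : 0 < Cmod l) by (apply Cmod_gt_0; auto).
destruct (Hl (e * Cmod l / B)) as [N HN].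
{ apply Rdiv_lt_0_compat; auto. apply Rmult_lt_0_compat; auto. }
exists N; intros n Hn. specialize (HN n Hn).
replace (/ u n - / l)%C with (/ u n * (- (u n - l) / l))%C by (field; auto).
rewrite Cmod_mult, Cmod_div, Cmod_opp by auto.
apply Rle_lt_trans with (B * (Cmod (u n - l)%C / Cmod l)).
- apply Rmult_le_compat_r; auto. apply Rmult_le_pos; [apply Cmod_ge_0|].
  left; apply Rinv_0_lt_compat; auto.
- apply Rmult_lt_reg_r with (Cmod l / B); [apply Rdiv_lt_0_compat; auto|].
  replace (B * (Cmod (u n - l)%C / Cmod l) * (Cmod l / B)) with (Cmod (u n - l)%C)
    by (field; lra).
  replace (e * (Cmod l / B)) with (e * Cmod l / B) by (field; lra). auto.
Qed.

Lemma seq_lim_subseq u l (h : nat -> nat) : (forall N, exists M, forall n, (M <= n)%nat -> (N <= h n)%nat) ->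
  seq_lim u l -> seq_lim (fun n => u (h n)) l.
Proof.
intros Hh Hu e He. destruct (Hu e He) as [N HN]. destruct (Hh N) as [M HM].
exists M; auto.
Qed.

Lemma seq_lim_ext_eventually u v l M : (forall n, (M <= n)%nat -> u n = v n) ->
  seq_lim u l -> seq_lim v l.
Proof.
intros E Hu e He. destruct (Hu e He) as [N HN]. exists (N + M)%nat; intros n Hn.
rewrite <- E by lia. apply HN; lia.
Qed.

Lemma RtoC_1_neq_0 : RtoC 1 <> RtoC 0.
Proof. intros H; apply RtoC_inj in H; lra. Qed.

Section Jacobi.

Context (tau : C) (tau_pos : 0 < Im tau).

(** * A finite form of Jacobi's identity *)

Definition poch (n : nat) : C := qpoch (epow tau 1) n.

Lemma poch_S n : poch (S n) = (poch n * (1 - mono tau 0 (Z.of_nat (S n))))%C.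
Proof.
unfold poch, mono. rewrite sgn_0, <- INR_IZR_INZ.
change (qpoch (epow tau 1) (S n)) with (qpoch (epow tau 1) n * (RtoC 1 - Cpow (epow tau 1) (S n)))%C.
rewrite Cpow_epow, Rmult_1_l. ring.
Qed.

Lemma one_minus_mono_neq_0 e : e <> 0%Z -> (1 - mono tau 0 e)%C <> RtoC 0.
Proof.
intros He H; apply (mono_neq_1 tau tau_pos e He).
replace (mono tau 0 e) with (1 - (1 - mono tau 0 e))%C by ring. rewrite H; ring.
Qed.

Lemma poch_neq_0 n : poch n <> RtoC 0.
Proof.
induction n as [|n IH]; [apply RtoC_1_neq_0|].
rewrite poch_S. apply Cmult_neq_0; auto. apply one_minus_mono_neq_0; lia.
Qed.

(** [1 / (q; q)_k], with the usual value [0] for negative [k]. *)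
Definition ipoch (k : Z) : C := if (0 <=? k)%Z then (/ poch (Z.to_nat k))%C else RtoC 0.

(** At [k = 0] the factor [1 - q^0] agrees with the value 0 at negative arguments, so the rules
    below have no boundary cases. *)
Lemma ipoch_pred k : ipoch (k - 1) = ((1 - mono tau 0 k) * ipoch k)%C.
Proof.
unfold ipoch. destruct (Z.leb_spec 0 (k - 1)); destruct (Z.leb_spec 0 k); try lia.
- replace (Z.to_nat k) with (S (Z.to_nat (k - 1))) by lia.
  rewrite poch_S. replace (Z.of_nat (S (Z.to_nat (k - 1)))) with k by lia.
  field; split; [apply one_minus_mono_neq_0; lia|apply poch_neq_0].
- replace k with 0%Z by lia. rewrite mono_0; ring.
- ring.
Qed.

(** Coefficient of [x^k] in the finite product [(x; q)_m]. *)
Definition qbin (m : nat) (k : Z) : C :=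
  (mono tau k (binom2 k) * poch m * ipoch k * ipoch (Z.of_nat m - k))%C.

Lemma qbin_0 k : qbin 0 k = if (k =? 0)%Z then RtoC 1 else RtoC 0.
Proof.
unfold qbin, ipoch. destruct (Z.eqb_spec k 0) as [->|Hk].
- change (binom2 0) with 0%Z. rewrite mono_0. simpl. unfold poch; simpl. field.
- destruct (Z.leb_spec 0 k); destruct (Z.leb_spec 0 (Z.of_nat 0 - k)); try lia; ring.
Qed.

(** The q-Pascal rule. Every term is a multiple of [ipoch k * ipoch (m + 1 - k)], and what remains
    is [1 - q^(m+1) = (1 - q^(m+1-k)) + q^(m+1-k) (1 - q^k)]. *)
Lemma qbin_S m k : qbin (S m) k = (qbin m k - mono tau 0 (Z.of_nat m) * qbin m (k - 1))%C.
Proof.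
unfold qbin. set (M := Z.of_nat m).
replace (Z.of_nat (S m)) with (M + 1)%Z by (unfold M; lia).
assert (E1 := ipoch_pred k). assert (E2 := ipoch_pred (M + 1 - k)).
replace (M + 1 - k - 1)%Z with (M - k)%Z in E2 by lia.
replace (M - (k - 1))%Z with (M + 1 - k)%Z by lia.
rewrite E1, E2, poch_S. replace (Z.of_nat (S m)) with (M + 1)%Z by (unfold M; lia).
assert (B1 := binom2_spec k). assert (B2 := binom2_spec (k - 1)).
replace (mono tau k (binom2 k)) with (- mono tau 0 (k - 1) * mono tau (k - 1) (binom2 (k - 1)))%C.
2:{ transitivity (- (mono tau 0 (k - 1) * mono tau (k - 1) (binom2 (k - 1))))%C; [ring|].
    rewrite mono_mul. symmetry; apply (mono_opp _ _ _ _ _ 0); lia. }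
replace (mono tau 0 M) with (mono tau 0 (k - 1) * mono tau 0 (M + 1 - k))%C.
2:{ rewrite mono_mul; apply (mono_eq _ _ _ _ _ 0); lia. }
replace (mono tau 0 (M + 1)) with (mono tau 0 k * mono tau 0 (M + 1 - k))%C.
2:{ rewrite mono_mul; apply (mono_eq _ _ _ _ _ 0); lia. }
ring.
Qed.

(** The terms of [(x; q)_m] at [x = q^(-n)]; for [m = 2 n + 1] they are
    proportional to those of the theta series, each weighted by [qweight]. *)
Definition xqbin (n m : nat) (k : Z) : C :=
  (mono tau 0 (- (Z.of_nat n * k)) * qbin m k)%C.

(** The value [(q^(-n); q)_m]; it acquires the factor [1 - 1] as soon as [m > n]. *)
Fixpoint xpoch (n m : nat) : C :=
  match m with
  | O => RtoC 1
  | S m => (xpoch n m * (1 - mono tau 0 (Z.of_nat m - Z.of_nat n)))%C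
  end.

Lemma xqbin_S n m k : xqbin n (S m) k =
  (xqbin n m k - mono tau 0 (Z.of_nat m - Z.of_nat n) * xqbin n m (k + -1)%Z)%C.
Proof.
unfold xqbin. rewrite qbin_S. replace (k + -1)%Z with (k - 1)%Z by lia.
assert (E : (mono tau 0 (- (Z.of_nat n * k)) * mono tau 0 (Z.of_nat m) =
  mono tau 0 (Z.of_nat m - Z.of_nat n) * mono tau 0 (- (Z.of_nat n * (k - 1))))%C).
{ rewrite !mono_mul; apply (mono_eq _ _ _ _ _ 0); lia. }
rewrite Cmult_assoc, <- E. ring.
Qed.

Lemma xqbin_sum n m : has_sum (xqbin n m) (xpoch n m).
Proof.
induction m as [|m IH].
- assert (H := has_sum_single (xqbin n 0) 0%Z).
  replace (xqbin n 0 0) with (RtoC 1) in H.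
  + apply H; intros k Hk. unfold xqbin; rewrite qbin_0. apply Z.eqb_neq in Hk; rewrite Hk; ring.
  + unfold xqbin; rewrite qbin_0; simpl. rewrite Z.mul_0_r; simpl. rewrite mono_0; ring.
- apply (has_sum_ext (fun k => xqbin n m k -
    mono tau 0 (Z.of_nat m - Z.of_nat n) * xqbin n m (k + -1)%Z)%C).
  + intros k; rewrite xqbin_S; easy.
  + simpl. replace (xpoch n m * (1 - mono tau 0 (Z.of_nat m - Z.of_nat n)))%C with
      (xpoch n m - mono tau 0 (Z.of_nat m - Z.of_nat n) * xpoch n m)%C by ring.
    apply has_sum_minus; auto. apply has_sum_scal, (has_sum_shift (-1) _ _ IH).
Qed.

(** The coefficientwise form of [x d/dx], applied to [(x; q)_(m+1) = (x; q)_m (1 - x q^m)]. *)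
Lemma xqbin_derive_S n m e :
  has_sum (fun k => (RtoC (IZR k) * xqbin n m k)%C) e ->
  has_sum (fun k => (RtoC (IZR k) * xqbin n (S m) k)%C)
    (e * (1 - mono tau 0 (Z.of_nat m - Z.of_nat n))
     - mono tau 0 (Z.of_nat m - Z.of_nat n) * xpoch n m)%C.
Proof.
intros H. set (y := mono tau 0 (Z.of_nat m - Z.of_nat n)).
assert (H1 := has_sum_plus _ _ _ _ (has_sum_shift (-1) _ _ H)
  (has_sum_shift (-1) _ _ (xqbin_sum n m))).
assert (H2 := has_sum_minus _ _ _ _ H (has_sum_scal y _ _ H1)).
replace (e * (1 - y) - y * xpoch n m)%C with (e - y * (e + xpoch n m))%C by ring.
revert H2; apply has_sum_ext; intros k. rewrite xqbin_S, plus_IZR, RtoC_plus.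
replace (IZR (-1)) with (- (1)) by ring. rewrite RtoC_opp. fold y. ring.
Qed.

Lemma xpoch_vanish n i : xpoch n (S n + i) = RtoC 0.
Proof.
induction i as [|i IH].
- rewrite Nat.add_0_r; simpl. rewrite Z.sub_diag, mono_0; ring.
- rewrite Nat.add_succ_r; simpl; simpl in IH. rewrite IH; ring.
Qed.

(** At the simple zero [x = q^(-n)] of [(x; q)_(n+1+i)] only the vanishing factor is differentiated;
    the earlier factors give [(q^(-n); q)_n] and the later ones [(q; q)_i]. *)
Lemma xqbin_derive n i :
  has_sum (fun k => (RtoC (IZR k) * xqbin n (S n + i) k)%C) (- (xpoch n n * poch i))%C.
Proof.
induction i as [|i IH].
- assert (Hex : forall m, exists e, has_sum (fun k => (RtoC (IZR k) * xqbin n m k)%C) e).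
  { induction m as [|m [e IH]].
    - exists (RtoC 0). apply (has_sum_ext (fun _ => RtoC 0)); [|apply has_sum_zero].
      intros k; unfold xqbin; rewrite qbin_0. destruct (Z.eqb_spec k 0) as [->|]; ring.
    - eexists; apply xqbin_derive_S, IH. }
  (* The derivative [e] of the first [n] factors stays unknown: the next factor multiplies it by
     [1 - q^0 = 0]. *)
  destruct (Hex n) as [e He]. apply xqbin_derive_S in He.
  rewrite Nat.add_0_r. rewrite Z.sub_diag, mono_0 in He.
  replace (- (xpoch n n * poch 0))%C with (e * (1 - 1) - 1 * xpoch n n)%C; auto.
  unfold poch; simpl; ring.
- rewrite Nat.add_succ_r. apply xqbin_derive_S in IH. rewrite xpoch_vanish in IH.
  replace (Z.of_nat (S n + i) - Z.of_nat n)%Z with (Z.of_nat (S i)) in IH by lia.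
  match type of IH with has_sum _ ?v => replace v with (- (xpoch n n * poch (S i)))%C in IH end.
  + exact IH.
  + rewrite poch_S; ring.
Qed.

(** Each factor satisfies [1 - q^(-k) = - q^(-k) (1 - q^k)]; the auxiliary statement converts them
    one at a time, from [k = n] downwards. *)
Lemma xpoch_diag n : xpoch n n = (mono tau (Z.of_nat n) (- binom2 (Z.of_nat n + 1)) * poch n)%C.
Proof.
assert (H : forall m, (m <= n)%nat -> (xpoch n m * poch (n - m) =
  mono tau (Z.of_nat m) (binom2 (Z.of_nat m) - Z.of_nat n * Z.of_nat m) * poch n)%C).
{ induction m as [|m IH]; intros Hm.
  - rewrite Nat.sub_0_r; simpl. rewrite Z.mul_0_r; change (binom2 0 - 0)%Z with 0%Z.
    rewrite mono_0; easy.
  - specialize (IH ltac:(lia)).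
    replace (n - m)%nat with (S (n - S m)) in IH by lia. rewrite poch_S in IH.
    replace (Z.of_nat (S (n - S m))) with (Z.of_nat n - Z.of_nat m)%Z in IH by lia.
    set (M := Z.of_nat m) in *. replace (Z.of_nat (S m)) with (M + 1)%Z by (unfold M; lia).
    set (y := mono tau 0 (Z.of_nat n - M)) in *.
    assert (Ey : (y * mono tau 0 (M - Z.of_nat n) = 1)%C).
    { unfold y. rewrite mono_mul, <- mono_0 with (tau := tau). apply (mono_eq _ _ _ _ _ 0); lia. }
    simpl. fold M.
    transitivity (- mono tau 0 (M - Z.of_nat n) * (xpoch n m * (poch (n - S m) * (1 - y)))
      + (1 - y * mono tau 0 (M - Z.of_nat n)) * (xpoch n m * poch (n - S m)))%C; [ring|].
    rewrite Ey, IH.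
    rewrite (mono_opp _ (M + 1) _ (0 + M) (M - Z.of_nat n + (binom2 M - Z.of_nat n * M)) 0);
      [rewrite <- mono_mul; ring|lia|].
    assert (B1 := binom2_spec M). assert (B2 := binom2_spec (M + 1)). lia. }
specialize (H n (le_n n)). rewrite Nat.sub_diag in H.
transitivity (xpoch n n * poch 0)%C; [unfold poch; simpl; ring|]. rewrite H. f_equal.
apply (mono_eq _ _ _ _ _ 0); [lia|].
assert (B1 := binom2_spec (Z.of_nat n)). assert (B2 := binom2_spec (Z.of_nat n + 1)). lia.
Qed.

(** For fixed [l] it tends to [1 / (q)_inf]; for fixed [n] it vanishes outside
    [-n <= l <= n + 1]. *)
Definition qweight (n : nat) (l : Z) : C :=
  (poch (S n + n) * ipoch (Z.of_nat n + l) * ipoch (Z.of_nat n + 1 - l))%C.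

(** Putting [k = l + n] recentres the quadratic exponent, so that the theta coefficient appears, up
    to a factor independent of [l]. *)
Lemma xqbin_shift n l : xqbin n (S n + n) (l + Z.of_nat n) =
  (mono tau (Z.of_nat n) (- binom2 (Z.of_nat n + 1)) * (tcoef tau l * qweight n l))%C.
Proof.
unfold xqbin, qbin, qweight, tcoef. set (N := Z.of_nat n).
replace (Z.of_nat (S n + n) - (l + N))%Z with (N + 1 - l)%Z by (unfold N; lia).
replace (l + N)%Z with (N + l)%Z by lia.
rewrite !Cmult_assoc, !mono_mul. do 3 f_equal.
apply (mono_eq _ _ _ _ _ 0); [lia|].
assert (B1 := binom2_spec l). assert (B2 := binom2_spec (N + 1)).
assert (B3 := binom2_spec (N + l)). lia.
Qed.

(** Its limit is [sum_l (-1)^l l q^(l(l-1)/2) = - (q)^3], once the limit [1 / (q)_inf] of the weight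
    is moved to the right. *)
Lemma finite_jacobi n :
  has_sum (fun l => (RtoC (IZR l) * tcoef tau l * qweight n l)%C) (- (poch n * poch n))%C.
Proof.
set (u := mono tau (Z.of_nat n) (- binom2 (Z.of_nat n + 1))).
assert (Hu : u <> RtoC 0) by apply mono_neq_0.
assert (H0 := has_sum_shift (Z.of_nat n) _ _ (xqbin_sum n (S n + n))).
assert (H1 := has_sum_shift (Z.of_nat n) _ _ (xqbin_derive n n)).
rewrite xpoch_vanish in H0. rewrite xpoch_diag in H1.
(* The weight is [k = l + n]; subtracting [n] times the vanishing sum [H0] leaves [l]. *)
assert (H := has_sum_scal (/ u)%C _ _
  (has_sum_minus _ _ _ _ H1 (has_sum_scal (RtoC (IZR (Z.of_nat n))) _ _ H0))).
fold u in H.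
match type of H with has_sum _ ?v => replace v with (- (poch n * poch n))%C in H by (field; auto) end.
revert H; apply has_sum_ext; intros l.
rewrite xqbin_shift; fold u. rewrite plus_IZR, RtoC_plus. field; auto.
Qed.

(** * Convergence of the q-factorials and the limit of the finite identity *)

Definition qabs (n : nat) : R := Cmod (mono tau 0 (Z.of_nat (S n))).

Lemma qabs_summable : summable qabs.
Proof.
assert (Hi : forall x y, Z.of_nat (S x) = Z.of_nat (S y) -> x = y) by (intros; lia).
assert (H := summable_inj (fun n => Z.of_nat (S n)) _ Hi
  (summable_exp_abs (decay tau) (decay_pos tau tau_pos))).
revert H; apply summable_le; intros n. unfold qabs; rewrite Cmod_mono.
right. rewrite Rabs_pos_eq; auto. apply IZR_le; lia.
Qed.

Lemma qabs_bounds n : 0 < qabs n <= qabs 0 /\ qabs 0 < 1.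
Proof.
assert (Hd := decay_pos tau tau_pos). unfold qabs; rewrite !Cmod_mono. repeat split.
- apply exp_pos.
- apply exp_le_mono, Ropp_le_contravar, Rmult_le_compat_l; [lra|apply IZR_le; lia].
- rewrite <- exp_0; apply exp_increasing. simpl; lra.
Qed.

Lemma poch_bound : exists B, 0 <= B /\ forall n, Cmod (poch n) <= B /\ Cmod (/ poch n)%C <= B.
Proof.
destruct qabs_summable as [K HK].
(* For [0 < x <= |q|], [1 / (1 - x) = 1 + x / (1 - x) <= exp (c x)]. *)
set (c := 1 / (1 - qabs 0)).
assert (Hc : 0 < c).
{ apply Rdiv_lt_0_compat; [lra|]. destruct (qabs_bounds 0); lra. }
assert (H : forall n, Cmod (poch n) <= exp (rsum qabs (seq 0 n)) /\
   Cmod (/ poch n)%C <= exp (c * rsum qabs (seq 0 n))).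
{ induction n as [|n [IH1 IH2]].
  - simpl; rewrite Rmult_0_r, exp_0. unfold poch; simpl. rewrite Cmod_inv, Cmod_1; [lra|].
    apply RtoC_1_neq_0.
  - destruct (qabs_bounds n) as [[Q1 Q2] Q3].
    rewrite seq_S, rsum_app; simpl. rewrite Rplus_0_r, Rmult_plus_distr_l, !exp_plus, poch_S.
    assert (N := one_minus_mono_neq_0 (Z.of_nat (S n)) ltac:(lia)).
    split.
    + rewrite Cmod_mult. apply Rmult_le_compat; auto; try apply Cmod_ge_0.
      eapply Rle_trans; [apply Cmod_triangle|]. rewrite Cmod_1, Cmod_opp.
      apply exp_ineq1_le.
    + replace (/ (poch n * (1 - mono tau 0 (Z.of_nat (S n)))))%C with
        (/ poch n * / (1 - mono tau 0 (Z.of_nat (S n))))%C by (field; split; [|apply poch_neq_0]; auto).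
      rewrite Cmod_mult. apply Rmult_le_compat; auto; try apply Cmod_ge_0.
      rewrite Cmod_inv by auto.
      assert (L : 1 - qabs n <= Cmod (1 - mono tau 0 (Z.of_nat (S n)))%C).
      { unfold qabs. assert (T := Cmod_triangle (1 - mono tau 0 (Z.of_nat (S n)))%C
          (mono tau 0 (Z.of_nat (S n)))).
        replace (1 - mono tau 0 (Z.of_nat (S n)) + mono tau 0 (Z.of_nat (S n)))%C
          with (RtoC 1) in T by ring. rewrite Cmod_1 in T. lra. }
      apply Rle_trans with (/ (1 - qabs n)); [apply Rinv_le_contravar; lra|].
      apply Rle_trans with (1 + qabs n / (1 - qabs n)); [right; field; lra|].
      eapply Rle_trans; [apply exp_ineq1_le|]. apply exp_le_mono.
      unfold c, Rdiv. rewrite Rmult_1_l, Rmult_comm. apply Rmult_le_compat_r; [lra|].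
      apply Rinv_le_contravar; lra. }
exists (exp K + exp (c * K)). split; [assert (H1 := exp_pos K); assert (H2 := exp_pos (c * K)); lra|].
intros n. destruct (H n) as [H1 H2]. assert (HS := HK (seq 0 n) (seq_NoDup _ _)).
assert (E1 := exp_le_mono _ _ HS).
assert (E2 := exp_le_mono _ _ (Rmult_le_compat_l c _ _ (Rlt_le _ _ Hc) HS)).
assert (P1 := exp_pos K); assert (P2 := exp_pos (c * K)). lra.
Qed.

(** Consecutive differences are at most [B |q|^(n+1)], so the telescoping series converges. *)
Lemma poch_lim : seq_lim poch (qpoch_inf (epow tau 1)) /\ qpoch_inf (epow tau 1) <> RtoC 0.
Proof.
destruct poch_bound as (B & HB0 & HB).
assert (HS : abs_summable (fun n => (poch (S n) - poch n)%C)).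
{ apply (abs_summable_le _ (fun n => B * qabs n)); [|apply summable_scal; auto; apply qabs_summable].
  intros n. rewrite poch_S.
  replace (poch n * (1 - mono tau 0 (Z.of_nat (S n))) - poch n)%C
    with (- (poch n * mono tau 0 (Z.of_nat (S n))))%C by ring.
  rewrite Cmod_opp, Cmod_mult. apply Rmult_le_compat_r; [apply Cmod_ge_0|apply HB]. }
destruct (has_sum_exists _ HS) as [s Hs]. apply has_sum_series in Hs.
apply filterlim_seq_lim in Hs.
assert (Hl : seq_lim poch (s + 1)%C).
{ intros e He. destruct (Hs e He) as [N HN]. exists (S N); intros [|n] Hn; [lia|].
  specialize (HN n ltac:(lia)).
  assert (E : sum_n (G := C_R_NormedModule) (fun n => (poch (S n) - poch n)%C) n = (poch (S n) - 1)%C).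
  { clear. induction n as [|n IH]; [rewrite sum_O; unfold poch; easy|].
    rewrite sum_Sn, IH.
    change ((poch (S n) - 1) + (poch (S (S n)) - poch (S n)) = poch (S (S n)) - 1)%C. ring. }
  rewrite E in HN. replace (poch (S n) - (s + 1))%C with (poch (S n) - 1 - s)%C by ring. auto. }
destruct (seq_lim_inv poch _ B poch_neq_0 (fun n => proj2 (HB n)) Hl) as [Hn _].
assert (E : qpoch_inf (epow tau 1) = (s + 1)%C).
{ unfold qpoch_inf. apply (iota_filterlim_locally (V := C_R_CompleteNormedModule)).
  apply filterlim_seq_lim; auto. }
rewrite E; auto.
Qed.

(** With [P = (q)_inf], the limit of [finite_jacobi] reads [- kappa / P = - P^2]. The bound [B^3] on
    the weights provides the majorant for the exchange of limit and sum. *)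
Lemma kappa_qpoch : kappa tau = Cpow (qpoch_inf (epow tau 1)) 3.
Proof.
destruct poch_lim as [HL HN]. set (P := qpoch_inf (epow tau 1)) in *.
destruct poch_bound as (B & HB0 & HB).
destruct (seq_lim_inv poch _ B poch_neq_0 (fun n => proj2 (HB n)) HL) as [_ HI].
assert (Hw : forall n l, Cmod (qweight n l) <= B * B * B).
{ assert (Hi : forall k, Cmod (ipoch k) <= B).
  { intros k; unfold ipoch; destruct (0 <=? k)%Z; [apply HB|rewrite Cmod_0; auto]. }
  intros n l; unfold qweight. rewrite !Cmod_mult.
  apply Rmult_le_compat; auto; [apply Rmult_le_pos; apply Cmod_ge_0|apply Cmod_ge_0|].
  apply Rmult_le_compat; auto; try apply Cmod_ge_0. apply HB. }
assert (Hlim : forall l, seq_lim (fun n => qweight n l) (/ P)%C).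
{ intros l. replace (/ P)%C with (P * / P * / P)%C by (field; auto).
  apply (seq_lim_ext_eventually (fun n => poch (S n + n) *
     / poch (Z.to_nat (Z.of_nat n + l)) * / poch (Z.to_nat (Z.of_nat n + 1 - l)))%C _ _
     (Z.abs_nat l)).
  - intros n Hn. unfold qweight, ipoch.
    destruct (Z.leb_spec 0 (Z.of_nat n + l)); [|lia].
    destruct (Z.leb_spec 0 (Z.of_nat n + 1 - l)); [|lia]. easy.
  - apply seq_lim_mult; [apply seq_lim_mult|].
    + apply (seq_lim_subseq poch P (fun n => (S n + n)%nat)); auto.
      intros N; exists N; intros; lia.
    + apply (seq_lim_subseq (fun n => / poch n)%C _ (fun n => Z.to_nat (Z.of_nat n + l))); auto.
      intros N; exists (N + Z.abs_nat l)%nat; intros; lia.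
    + apply (seq_lim_subseq (fun n => / poch n)%C _ (fun n => Z.to_nat (Z.of_nat n + 1 - l))); auto.
      intros N; exists (N + Z.abs_nat l)%nat; intros; lia. }
assert (H := has_sum_dominated
  (fun n l => (RtoC (IZR l) * tcoef tau l * qweight n l)%C)
  (fun l => (/ P * (RtoC (IZR l) * tcoef tau l))%C)
  (fun l => B * B * B * Cmod (RtoC (IZR l) * tcoef tau l)%C)
  (fun n => - (poch n * poch n))%C (/ P * - kappa tau)%C).
assert (HE : seq_lim (fun n => (- (poch n * poch n))%C) (/ P * - kappa tau)%C).
{ apply H.
  - apply summable_scal; [repeat apply Rmult_le_pos; auto|].
    apply tcoef_weighted_summable; auto.
  - intros n l. rewrite Cmod_mult, Rmult_comm.
    apply Rmult_le_compat_r; [apply Cmod_ge_0|apply Hw].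
  - intros l. rewrite (Cmult_comm (/ P)%C). apply seq_lim_mult; [apply seq_lim_const|apply Hlim].
  - apply finite_jacobi.
  - apply has_sum_scal, kappa_tcoef; auto. }
assert (HE' : seq_lim (fun n => (- (1) * (poch n * poch n))%C) (- (1) * (P * P))%C).
{ apply seq_lim_mult; [apply seq_lim_const|]. apply seq_lim_mult; auto. }
assert (E : (/ P * - kappa tau = - (1) * (P * P))%C).
{ apply (seq_lim_unique _ _ _ HE). apply (seq_lim_ext_eventually _ _ _ O) with (2 := HE').
  intros n _; ring. }
transitivity (- P * (/ P * - kappa tau))%C; [field; auto|].
rewrite E. simpl; ring.
Qed.

Lemma kappa_neq_0 : kappa tau <> RtoC 0.
Proof. rewrite kappa_qpoch. apply Cpow_nz, poch_lim. Qed.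

End Jacobi.

(** * The expansion of the character *)

Definition zpow (w : C) (u : Z) : C := epow w (IZR u).

Lemma zpow_add w u v : zpow w (u + v) = (zpow w u * zpow w v)%C.
Proof. unfold zpow; rewrite plus_IZR; apply epow_plus. Qed.

Lemma zpow_0 w : zpow w 0 = RtoC 1.
Proof. apply epow_0. Qed.

(** Chosen so that [|z| = exp (- growth w)]; the annulus becomes [|growth w| < decay tau]. *)
Definition growth (w : C) : R := 2 * PI * Im w.

Lemma Cmod_zpow w u : Cmod (zpow w u) = exp (- (growth w * IZR u)).
Proof. unfold zpow, growth; apply Cmod_epow. Qed.

Lemma Cmod_zpow_le w u : Cmod (zpow w u) <= exp (Rabs (growth w) * Rabs (IZR u)).
Proof.
rewrite Cmod_zpow. apply exp_le_mono. rewrite <- Rabs_mult, <- Rabs_Ropp. apply Rle_abs.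
Qed.

Section Character.

Context (tau : C) (tau_pos : 0 < Im tau).

Lemma Theta_summable (p n m : Z) w : (0 < p)%Z -> (0 < m)%Z ->
  abs_summable (fun k => (mono tau 0 (p * (m * (k * k) + n * k)) * zpow w (- m * k))%C).
Proof.
intros Hp Hm.
apply (abs_summable_quad tau tau_pos _ (fun k => p * (m * (k * k) + n * k))%Z
  (2 * p * m) (2 * p * n) 0 (Rabs (growth w) * IZR m) 1); [nia|lra|intros; ring|].
intros k. rewrite Cmod_mult, Rmult_1_l, Rmult_comm.
apply Rmult_le_compat_r; [apply Cmod_ge_0|].
eapply Rle_trans; [apply Cmod_zpow_le|]. right.
rewrite mult_IZR, Rabs_mult, opp_IZR, Rabs_Ropp, (Rabs_pos_eq (IZR m)) by (apply IZR_le; lia).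
f_equal; ring.
Qed.

(** The term [k0 = 0] carries all fractional exponents; dividing by it leaves integral powers of [q]
    and [z]. *)
Lemma Theta_eq (p n m : Z) w V : (0 < p)%Z -> (0 < m)%Z ->
  has_sum (fun k => (mono tau 0 (p * (m * (k * k) + n * k)) * zpow w (- m * k))%C) V ->
  Theta n m w (RtoC (IZR p) * tau)%C =
    (epow tau (IZR p * IZR n ^ 2 / (4 * IZR m)) * epow w (- (IZR n / 2)) * V)%C.
Proof.
intros Hp Hm HV. set (c := (epow tau (IZR p * IZR n ^ 2 / (4 * IZR m)) * epow w (- (IZR n / 2)))%C).
assert (E : forall k0, (c * (mono tau 0 (p * (m * (k0 * k0) + n * k0)) * zpow w (- m * k0)))%C =
  (let k := IZR k0 + IZR n / (2 * IZR m) in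
    (epow (RtoC (IZR p) * tau) (IZR m * k ^ 2) * epow w (- (IZR m * k)))%C)).
{ intros k0; simpl. rewrite epow_scal. unfold c, mono, zpow. rewrite sgn_0.
  assert (Hm' : IZR m <> 0) by (apply not_0_IZR; lia).
  transitivity ((epow tau (IZR p * IZR n ^ 2 / (4 * IZR m)) * epow tau (IZR (p * (m * (k0 * k0) + n * k0))))
   * (epow w (- (IZR n / 2)) * epow w (IZR (- m * k0))))%C; [ring|].
  rewrite <- !epow_plus, !mult_IZR, plus_IZR, !mult_IZR, opp_IZR.
  f_equal; f_equal; field; auto. }
unfold Theta. apply Zsum_eq.
- apply (abs_summable_ext _ _ E), abs_summable_scal, Theta_summable; auto.
- apply (has_sum_ext _ _ _ E), has_sum_scal; auto.
Qed.

Lemma ztheta_summable w : abs_summable (fun l => (tcoef tau l * zpow w l)%C).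
Proof.
apply (abs_summable_quad tau tau_pos _ binom2 1 (-1) 0 (Rabs (growth w)) 1); [lia|lra| |].
- intros k. assert (H := binom2_spec k); lia.
- intros k. rewrite Cmod_mult, Rmult_1_l, Rmult_comm. unfold tcoef. rewrite !Cmod_mono.
  apply Rmult_le_compat_r; [left; apply exp_pos|apply Cmod_zpow_le].
Qed.

Definition ztheta (w : C) : C := Zsum (fun l => (tcoef tau l * zpow w l)%C).

Lemma ztheta_sum w : has_sum (fun l => (tcoef tau l * zpow w l)%C) (ztheta w).
Proof. apply has_sum_Zsum, ztheta_summable. Qed.

(** The even terms [l = -2 k] of [j(z; q)] form [Theta_{1,2}], the odd terms [l = 1 - 2 k] form
    [- Theta_{-1,2}], up to the common fractional power. *)
Lemma WK_den_eq w : WK_den w tau = (epow tau (1 / 8) * epow w (- (1 / 2)) * ztheta w)%C.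
Proof.
destruct (has_sum_split (fun k => (-2 * k)%Z) (fun k => (1 - 2 * k)%Z)
  (fun l => (tcoef tau l * zpow w l)%C)) as (s1 & s2 & H1 & H2 & H3);
  [intros; lia|intros; lia|intros; lia| |apply ztheta_summable|].
{ intros t; destruct (Zeven_odd_dec t) as [[y ->]%Zeven_ex|[y ->]%Zodd_ex];
  [left; exists (- y)%Z|right; exists (- y)%Z]; lia. }
rewrite (has_sum_unique _ _ _ (ztheta_sum w) H3).
assert (Et : (RtoC (IZR 1) * tau = tau)%C) by ring.
assert (T1 := Theta_eq 1 1 2 w s1 ltac:(lia) ltac:(lia)).
assert (T2 := Theta_eq 1 (-1) 2 w (- (zpow w (-1) * s2))%C ltac:(lia) ltac:(lia)).
rewrite Et in T1, T2. unfold WK_den. rewrite T1, T2.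
- replace (IZR 1 * IZR 1 ^ 2 / (4 * 2)) with (1 / 8) by field.
  replace (IZR 1 * IZR (-1) ^ 2 / (4 * 2)) with (1 / 8) by field.
  replace (epow w (- (-1 / 2))) with (epow w (- (1 / 2)) * zpow w 1)%C.
  + transitivity (epow tau (1 / 8) * epow w (- (1 / 2)) * (s1 + zpow w 1 * zpow w (-1) * s2))%C; [ring|].
    rewrite <- zpow_add, zpow_0; ring.
  + unfold zpow; rewrite <- epow_plus; f_equal; field.
- apply has_sum_opp, (has_sum_scal (zpow w (-1))) in H2.
  replace (- (zpow w (-1) * s2))%C with (zpow w (-1) * - s2)%C by ring.
  revert H2; apply has_sum_ext; intros k. unfold tcoef.
  assert (B := binom2_spec (1 - 2 * k)).
  rewrite (mono_opp tau (1 - 2 * k) _ 0 (1 * (2 * (k * k) + -1 * k)) (- k)) by lia.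
  transitivity (mono tau 0 (1 * (2 * (k * k) + -1 * k)) * (zpow w (-1) * zpow w (1 - 2 * k)))%C; [ring|].
  rewrite <- zpow_add; do 2 f_equal; lia.
- revert H1; apply has_sum_ext; intros k. unfold tcoef.
  assert (B := binom2_spec (-2 * k)). f_equal.
  apply (mono_eq _ _ _ _ _ (- k)); lia.
Qed.

(** As [u -> -inf] each term decays by itself. As [u -> +inf] both tend to 1, and
    [A_c = 1 - q^(c+1) A_(c+1)] cancels the constants. The dependence on [a] and [b] is explicit
    because they vary with the index of the numerator. *)
Lemma rdiff_bound : exists K, 0 <= K /\ forall a b u,
  Cmod (rcoef tau (u - a) - rcoef tau (u - b))%C <=
  K * (exp (decay tau * Rabs (IZR a)) * exp (decay tau * Rabs (IZR b)))
    * exp (- (decay tau * Rabs (IZR u))).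
Proof.
destruct (rcoef_bound tau tau_pos) as (K & HK & H). exists (2 * K); split; [lra|].
assert (Hd := decay_pos tau tau_pos). set (D := decay tau) in *.
intros a b u.
assert (X : exists X : Z -> C,
  (rcoef tau (u - a) - rcoef tau (u - b) = X a - X b)%C /\
  forall c, Cmod (X c) <= K * (exp (D * Rabs (IZR c)) * exp (- (D * Rabs (IZR u))))).
{ destruct (Z_le_gt_dec 0 u) as [Hu|Hu].
  - exists (fun c => (- (mono tau 0 (u - c + 1) * rcoef tau (u - c + 1)))%C); split.
    + assert (R1 := rcoef_succ tau tau_pos (u - a)). assert (R2 := rcoef_succ tau tau_pos (u - b)).
      transitivity ((rcoef tau (u - a) + mono tau 0 (u - a + 1) * rcoef tau (u - a + 1))
        - (rcoef tau (u - b) + mono tau 0 (u - b + 1) * rcoef tau (u - b + 1))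
        + (- (mono tau 0 (u - a + 1) * rcoef tau (u - a + 1))
        - - (mono tau 0 (u - b + 1) * rcoef tau (u - b + 1))))%C; [ring|].
      rewrite R1, R2; ring.
    + intros c. rewrite Cmod_opp, Cmod_mult, Cmod_mono, Rmult_comm, <- exp_plus.
      apply Rmult_le_compat; [apply Cmod_ge_0|left; apply exp_pos|apply H|].
      apply exp_le_mono. rewrite (Rabs_pos_eq (IZR u)) by (apply IZR_le; auto).
      rewrite plus_IZR, minus_IZR. assert (HA := Rle_abs (IZR c)). fold D. nra.
  - exists (fun c => rcoef tau (u - c)); split; [ring|]. intros c.
    eapply Rle_trans; [apply H|]. rewrite <- exp_plus. apply Rmult_le_compat_l; auto.
    apply exp_le_mono. rewrite (Rabs_left1 (IZR u)) by (apply IZR_le; lia).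
    rewrite minus_IZR. assert (HA := Rle_abs (- IZR c)). rewrite Rabs_Ropp in HA. fold D. nra. }
destruct X as (X & -> & HX).
eapply Rle_trans; [apply Cmod_triangle|]. rewrite Cmod_opp.
assert (Ha := HX a). assert (Hb := HX b).
set (x := exp (D * Rabs (IZR a))) in *. set (y := exp (D * Rabs (IZR b))) in *.
set (z := exp (- (D * Rabs (IZR u)))) in *.
assert (G : forall c, 1 <= exp (D * Rabs (IZR c))).
{ intros c. rewrite <- exp_0 at 1. apply exp_le_mono, Rmult_le_pos; [lra|apply Rabs_pos]. }
assert (Gx : 1 <= x) by apply G. assert (Gy : 1 <= y) by apply G.
assert (Hz : 0 < z) by apply exp_pos.
(* The factor 2 and the product form come from [x + y <= 2 x y] for [x, y >= 1]. *)
apply Rle_trans with (K * z * (x + y)); [lra|].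
replace (2 * K * (x * y) * z) with (K * z * (2 * (x * y))) by ring.
apply Rmult_le_compat_l; [apply Rmult_le_pos; lra|nra].
Qed.

Lemma annulus_summable w : Rabs (growth w) < decay tau ->
  summable (fun u => exp (- (decay tau * Rabs (IZR u))) * Cmod (zpow w u)).
Proof.
intros Hw. assert (H := summable_exp_abs (decay tau - Rabs (growth w)) ltac:(lra)).
revert H; apply summable_le; intros u.
replace (- ((decay tau - Rabs (growth w)) * Rabs (IZR u))) with
  (- (decay tau * Rabs (IZR u)) + Rabs (growth w) * Rabs (IZR u)) by ring.
rewrite exp_plus. apply Rmult_le_compat_l; [left; apply exp_pos|apply Cmod_zpow_le].
Qed.

Lemma rdiff_summable w a b : Rabs (growth w) < decay tau ->
  abs_summable (fun u => ((rcoef tau (u - a) - rcoef tau (u - b)) * zpow w u)%C).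
Proof.
intros Hw. destruct rdiff_bound as (K & HK & H).
set (c := K * (exp (decay tau * Rabs (IZR a)) * exp (decay tau * Rabs (IZR b)))).
apply (abs_summable_le _ (fun u => c * (exp (- (decay tau * Rabs (IZR u))) * Cmod (zpow w u)))).
- intros u. rewrite Cmod_mult, <- Rmult_assoc. apply Rmult_le_compat_r; [apply Cmod_ge_0|apply H].
- apply summable_scal; [|apply annulus_summable; auto].
  apply Rmult_le_pos; auto. apply Rmult_le_pos; left; apply exp_pos.
Qed.

(** The difference of two expansions of [z^a / j(z; q)] converges on the whole
    annulus, because the pole at [z = 1] cancels. *)
Lemma ztheta_rdiff w a b s : Rabs (growth w) < decay tau ->
  has_sum (fun u => ((rcoef tau (u - a) - rcoef tau (u - b)) * zpow w u)%C) s ->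
  (ztheta w * s = kappa tau * (zpow w a - zpow w b))%C.
Proof.
intros Hw Hs.
assert (H := has_sum_cauchy _ _
  (fun u => ((if (u - a =? 0)%Z then kappa tau else RtoC 0) * zpow w u
     - (if (u - b =? 0)%Z then kappa tau else RtoC 0) * zpow w u)%C) _ _
  (ztheta_summable w) (rdiff_summable w a b Hw) (ztheta_sum w) Hs).
assert (S1 : forall c, has_sum (fun u => ((if (u - c =? 0)%Z then kappa tau else RtoC 0) * zpow w u)%C)
   (kappa tau * zpow w c)%C).
{ intros c. set (f := fun u => ((if (u - c =? 0)%Z then kappa tau else RtoC 0) * zpow w u)%C).
  replace (kappa tau * zpow w c)%C with (f c).
  - apply (has_sum_single f c). intros x Hx; unfold f.
    destruct (Z.eqb_spec (x - c) 0); [lia|ring].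
  - unfold f. rewrite Z.sub_diag; easy. }
assert (S2 := has_sum_minus _ _ _ _ (S1 a) (S1 b)).
assert (E := fun X => has_sum_unique _ _ _ (H X) S2). rewrite E; [ring|].
clear E H; intros u; cbv beta.
assert (C1 := conv_sum tau tau_pos (u - a)). assert (C2 := conv_sum tau tau_pos (u - b)).
assert (C3 := has_sum_scal (zpow w u) _ _ (has_sum_minus _ _ _ _ C1 C2)).
match goal with |- has_sum _ ?v =>
  match type of C3 with has_sum _ ?v' => replace v with v' by ring end end.
revert C3; apply has_sum_ext; intros l.
replace u with (l + (u - l))%Z at 1 by lia. rewrite zpow_add.
replace (u - l - a)%Z with (u - a - l)%Z by lia. replace (u - l - b)%Z with (u - b - l)%Z by lia.
ring.
Qed.

(** The choice [a = 1], [b = 0] gives [j(z; q) s = kappa (z - 1)], so a zero of [j] in the annulus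
    forces [z = 1]. *)
Lemma ztheta_neq_0 w : Rabs (growth w) < decay tau -> zpow w 1 <> RtoC 1 -> ztheta w <> RtoC 0.
Proof.
intros Hw Hz E. destruct (has_sum_exists _ (rdiff_summable w 1 0 Hw)) as [s Hs].
apply ztheta_rdiff in Hs; auto. rewrite E, zpow_0, Cmult_0_l in Hs.
apply (Cmult_neq_0 (kappa tau) (zpow w 1 - 1)%C); auto.
- apply kappa_neq_0; auto.
- intros H; apply Hz. replace (zpow w 1) with ((zpow w 1 - 1) + 1)%C by ring. rewrite H; ring.
Qed.

Definition wcoef (p p' l k : Z) : C := mono tau 0 (p * (p' * (k * k) + (l + 1) * k)).

(** Coefficient of [z^u] in [(q)^3] times the character, up to the fractional
    power of [q] and the shift of the exponent of [z] by [l / 2]. *)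
Definition scoef (p p' l u : Z) : C :=
  Zsum (fun k => (wcoef p p' l k * (rcoef tau (u + p' * k) - rcoef tau (u - p' * k - l - 1)))%C).

(** A majorant of product form makes the double sum over [(k, u)] absolutely summable. The quadratic
    exponent of [wcoef] absorbs the growth [exp (2 D p' |k|)] caused by the shifts. *)
Lemma character_bound (p p' l : Z) : (0 < p)%Z -> (0 < p')%Z ->
  exists F : Z -> R, (forall k, 0 <= F k) /\ summable F /\ forall k u,
    Cmod (wcoef p p' l k * (rcoef tau (u + p' * k) - rcoef tau (u - p' * k - l - 1)))%C
      <= F k * exp (- (decay tau * Rabs (IZR u))).
Proof.
intros Hp Hp'. destruct rdiff_bound as (K & HK & H).
set (D := decay tau) in *. assert (Hd : 0 < D) by apply (decay_pos tau tau_pos).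
set (M := K * exp (D * Rabs (IZR (l + 1)))).
assert (HM : 0 <= M) by (apply Rmult_le_pos; auto; left; apply exp_pos).
set (f := fun k => M * exp ((2 * D * IZR p') * Rabs (IZR k)) * Cmod (wcoef p p' l k)).
assert (Hf : forall k, 0 <= f k).
{ intros k; apply Rmult_le_pos; [|apply Cmod_ge_0]. apply Rmult_le_pos; auto; left; apply exp_pos. }
exists f; split; [|split]; auto.
- apply (summable_le _ (fun k => Cmod (RtoC (f k)))); [intros k; rewrite Cmod_R; apply Rle_abs|].
  apply (abs_summable_quad tau tau_pos (fun k => RtoC (f k))
    (fun k => p * (p' * (k * k) + (l + 1) * k))%Z
    (2 * p * p') (2 * p * (l + 1)) 0 (2 * D * IZR p') M); [nia|auto|intros; ring|].
  intros k. rewrite Cmod_R, Rabs_pos_eq by auto. unfold f, wcoef. lra.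
- intros k u. rewrite Cmod_mult.
  assert (H' := H (- p' * k)%Z (p' * k + l + 1)%Z u).
  replace (u - - p' * k)%Z with (u + p' * k)%Z in H' by ring.
  replace (u - (p' * k + l + 1))%Z with (u - p' * k - l - 1)%Z in H' by ring.
  assert (E : exp (D * Rabs (IZR (- p' * k))) * exp (D * Rabs (IZR (p' * k + l + 1))) <=
    exp (D * Rabs (IZR (l + 1))) * exp ((2 * D * IZR p') * Rabs (IZR k))).
  { rewrite <- !exp_plus. apply exp_le_mono.
    assert (E1 : Rabs (IZR (- p' * k)) = IZR p' * Rabs (IZR k)).
    { rewrite mult_IZR, opp_IZR, Rabs_mult, Rabs_Ropp, (Rabs_pos_eq (IZR p')); auto.
      apply IZR_le; lia. }
    assert (E2 : Rabs (IZR (p' * k + l + 1)) <= IZR p' * Rabs (IZR k) + Rabs (IZR (l + 1))).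
    { replace (p' * k + l + 1)%Z with (p' * k + (l + 1))%Z by ring. rewrite plus_IZR.
      eapply Rle_trans; [apply Rabs_triang|].
      rewrite mult_IZR, Rabs_mult, (Rabs_pos_eq (IZR p')); [lra|]. apply IZR_le; lia. }
    rewrite E1. apply Rmult_le_compat_l with (r := D) in E2; [|lra]. lra. }
  unfold f. set (X := Cmod (wcoef p p' l k)).
  assert (HX : 0 <= X) by apply Cmod_ge_0.
  set (Z0 := exp (- (D * Rabs (IZR u)))) in *. assert (HZ : 0 < Z0) by apply exp_pos.
  set (E0 := exp (2 * D * IZR p' * Rabs (IZR k))) in *.
  replace (M * E0 * X * Z0) with (X * (M * E0 * Z0)) by ring.
  apply Rmult_le_compat_l; auto.
  eapply Rle_trans; [apply H'|]. apply Rmult_le_compat_r; [lra|].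
  unfold M; rewrite Rmult_assoc. apply Rmult_le_compat_l; auto.
Qed.

Lemma scoef_summable p p' l u : (0 < p)%Z -> (0 < p')%Z ->
  abs_summable (fun k => (wcoef p p' l k * (rcoef tau (u + p' * k) - rcoef tau (u - p' * k - l - 1)))%C).
Proof.
intros Hp Hp'. destruct (character_bound p p' l Hp Hp') as (F & HF0 & HF & H).
apply (abs_summable_le _ (fun k => exp (- (decay tau * Rabs (IZR u))) * F k)).
- intros k. rewrite Rmult_comm; apply H.
- apply summable_scal; auto. left; apply exp_pos.
Qed.

Lemma scoef_sum p p' l u : (0 < p)%Z -> (0 < p')%Z ->
  has_sum (fun k => (wcoef p p' l k * (rcoef tau (u + p' * k) - rcoef tau (u - p' * k - l - 1)))%C)
    (scoef p p' l u).
Proof. intros; apply has_sum_Zsum, scoef_summable; auto. Qed.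

(** Replacing [k] by [-k] in the second theta series gives both series the same powers of [q]; the
    paired terms then vanish at [z = 1]. *)
Lemma WK_num_eq (p p' l : Z) w : (0 < p)%Z -> (0 < p')%Z -> exists V,
  has_sum (fun k => (wcoef p p' l k * (zpow w (- p' * k) - zpow w (p' * k + l + 1)))%C) V /\
  WK_num p p' l w tau =
   (epow tau (IZR p * IZR (l + 1) ^ 2 / (4 * IZR p')) * epow w (- (IZR (l + 1) / 2)) * V)%C.
Proof.
intros Hp Hp'.
destruct (has_sum_exists _ (Theta_summable p (l + 1) p' w Hp Hp')) as [V1 H1].
destruct (has_sum_exists _ (Theta_summable p (- (l + 1)) p' w Hp Hp')) as [V2 H2].
exists (V1 - zpow w (l + 1) * V2)%C; split.
- assert (H3 := has_sum_scal (zpow w (l + 1)) _ _ (has_sum_reflect 0 _ _ H2)).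
  generalize (has_sum_minus _ _ _ _ H1 H3). apply has_sum_ext; intros k.
  unfold wcoef. replace (p' * k + l + 1)%Z with ((l + 1) + (- p' * (0 - k)))%Z by ring.
  rewrite (zpow_add w (l + 1)).
  replace (p' * ((0 - k) * (0 - k)) + - (l + 1) * (0 - k))%Z with (p' * (k * k) + (l + 1) * k)%Z by ring.
  ring.
- unfold WK_num. rewrite (Theta_eq p (l + 1) p' w V1), (Theta_eq p (- (l + 1)) p' w V2) by auto.
  replace (epow w (- (IZR (- (l + 1)) / 2))) with (epow w (- (IZR (l + 1) / 2)) * zpow w (l + 1))%C.
  + rewrite opp_IZR. replace ((- IZR (l + 1)) ^ 2) with (IZR (l + 1) ^ 2) by ring. ring.
  + unfold zpow; rewrite <- epow_plus, opp_IZR; f_equal; field.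
Qed.

Lemma character_expansion (p p' l : Z) w : (0 < p)%Z -> (0 < p')%Z ->
  Rabs (growth w) < decay tau -> ztheta w <> RtoC 0 ->
  abs_summable (fun u => (scoef p p' l u * zpow w u)%C) /\
  has_sum (fun u => (scoef p p' l u * zpow w u)%C)
    (kappa tau * epow tau (- (- (1 / 8) + IZR p * IZR (l + 1) ^ 2 / (4 * IZR p')))
      * epow w (IZR l / 2) * chi p p' l w tau)%C.
Proof.
intros Hp Hp' Hw Ht.
destruct (character_bound p p' l Hp Hp') as (F & HF0 & HF & HB).
set (g := fun u => exp (- (decay tau * Rabs (IZR u))) * Cmod (zpow w u)).
assert (Hg : summable g) by (apply annulus_summable; auto).
assert (Hg0 : forall u, 0 <= g u).
{ intros u; apply Rmult_le_pos; [left; apply exp_pos|apply Cmod_ge_0]. }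
assert (HS : abs_summable (fun x : Z * Z => (wcoef p p' l (fst x) *
    ((rcoef tau (snd x - - p' * fst x) - rcoef tau (snd x - (p' * fst x + l + 1))) * zpow w (snd x)))%C)).
{ apply (abs_summable_le _ (fun x => F (fst x) * g (snd x))); [|apply summable_prod; auto].
  intros [k u]; simpl fst; simpl snd. specialize (HB k u).
  replace (u - - p' * k)%Z with (u + p' * k)%Z by ring.
  replace (u - (p' * k + l + 1))%Z with (u - p' * k - l - 1)%Z by ring.
  rewrite Cmult_assoc, Cmod_mult. unfold g; rewrite <- Rmult_assoc.
  apply Rmult_le_compat_r; [apply Cmod_ge_0|auto]. }
destruct (WK_num_eq p p' l w Hp Hp') as (V & HV & EV).
set (S := fun k => Zsum (fun u =>
  ((rcoef tau (u - - p' * k) - rcoef tau (u - (p' * k + l + 1))) * zpow w u)%C)).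
assert (HSk : forall k, has_sum (fun u =>
  ((rcoef tau (u - - p' * k) - rcoef tau (u - (p' * k + l + 1))) * zpow w u)%C) (S k)).
{ intros k; apply has_sum_Zsum, rdiff_summable; auto. }
assert (HSV : has_sum (fun k => (wcoef p p' l k * S k)%C) (kappa tau / ztheta w * V)%C).
{ apply (has_sum_scal (kappa tau / ztheta w)%C) in HV. revert HV; apply has_sum_ext; intros k.
  assert (E := ztheta_rdiff w _ _ _ Hw (HSk k)).
  transitivity (wcoef p p' l k * (kappa tau * (zpow w (- p' * k) - zpow w (p' * k + l + 1))) / ztheta w)%C;
    [field; auto|]. rewrite <- E; field; auto. }
assert (Hu : forall u, has_sum (fun k => (wcoef p p' l k *
    ((rcoef tau (u - - p' * k) - rcoef tau (u - (p' * k + l + 1))) * zpow w u))%C)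
    (scoef p p' l u * zpow w u)%C).
{ intros u. assert (H := has_sum_scal (zpow w u) _ _ (scoef_sum p p' l u Hp Hp')).
  rewrite Cmult_comm. revert H; apply has_sum_ext; intros k.
  replace (u - - p' * k)%Z with (u + p' * k)%Z by ring.
  replace (u - (p' * k + l + 1))%Z with (u - p' * k - l - 1)%Z by ring. ring. }
split.
- destruct HF as [M HM].
  assert (HM0 : 0 <= M) by (apply (HM nil); constructor).
  apply (abs_summable_le _ (fun u => M * g u)); [|apply summable_scal; auto].
  intros u. rewrite Cmod_mult. unfold g; rewrite <- Rmult_assoc.
  apply Rmult_le_compat_r; [apply Cmod_ge_0|].
  apply (has_sum_bound _ _ _ (scoef_sum p p' l u Hp Hp')). intros L HL.
  rewrite (Rmult_comm M).
  apply Rle_trans with (rsum (fun k => exp (- (decay tau * Rabs (IZR u))) * F k) L).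
  + apply rsum_le; intros k; rewrite Rmult_comm; auto.
  + rewrite rsum_scal. apply Rmult_le_compat_l; [left; apply exp_pos|auto].
(* Summing over [u] first gives the numerator divided by [j(z; q)]; summing over [k] first gives the
   coefficients [scoef]. *)
- assert (H := has_sum_swap _ _ _ _ HS (fun k => has_sum_scal (wcoef p p' l k) _ _ (HSk k)) Hu HSV).
  match goal with |- has_sum _ ?v => replace v with (kappa tau / ztheta w * V)%C; auto end.
  unfold chi. rewrite EV, WK_den_eq.
  set (c := IZR p * IZR (l + 1) ^ 2 / (4 * IZR p')).
  assert (N1 := epow_neq_0 tau (1 / 8)). assert (N2 := epow_neq_0 w (- (1 / 2))).
  replace (epow tau (- (- (1 / 8) + c))) with (epow tau (1 / 8) * epow tau (- c))%C
    by (rewrite <- epow_plus; f_equal; ring).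
  replace (epow w (- (1 / 2))) with (epow w (IZR l / 2) * epow w (- (IZR (l + 1) / 2)))%C in *
    by (rewrite <- epow_plus, plus_IZR; f_equal; field).
  assert (N3 := epow_neq_0 tau c). rewrite epow_opp. field.
  repeat split; auto; apply epow_neq_0.
Qed.

End Character.

(** * Uniqueness of Laurent coefficients and string functions *)

Lemma seq_lim_plus u v l m : seq_lim u l -> seq_lim v m ->
  seq_lim (fun n => (u n + v n)%C) (l + m)%C.
Proof.
intros Hu Hv e He.
destruct (Hu (e / 2)) as [N1 H1]; [lra|]. destruct (Hv (e / 2)) as [N2 H2]; [lra|].
exists (N1 + N2)%nat; intros n Hn.
specialize (H1 n ltac:(lia)); specialize (H2 n ltac:(lia)).
replace (u n + v n - (l + m))%C with ((u n - l) + (v n - m))%C by ring.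
eapply Rle_lt_trans; [apply Cmod_triangle|lra].
Qed.

Lemma is_series_csum (f : nat -> C) s : is_series (V := C_R_NormedModule) f s <->
  seq_lim (fun n => csum f (seq 0 (S n))) s.
Proof.
split; intros H; [apply filterlim_seq_lim in H|apply filterlim_seq_lim]; intros e He;
  destruct (H e He) as [N HN]; exists N; intros n Hn; specialize (HN n Hn).
- rewrite <- sum_n_csum; exact HN.
- rewrite sum_n_csum; exact HN.
Qed.

Lemma is_Zsum_lin (f g : Z -> C) s t c : is_Zsum f s -> is_Zsum g t ->
  is_Zsum (fun k => (c * (f k - g k))%C) (c * (s - t))%C.
Proof.
assert (H : forall (f g : nat -> C) s t,
   is_series (V := C_R_NormedModule) f s -> is_series (V := C_R_NormedModule) g t ->
   is_series (V := C_R_NormedModule) (fun k => (c * (f k - g k))%C) (c * (s - t))%C).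
{ clear; intros f g s t. rewrite !is_series_csum; intros Hf Hg.
  assert (H := seq_lim_mult _ _ _ _ (seq_lim_const c)
    (seq_lim_plus _ _ _ _ Hf (seq_lim_mult _ _ _ _ (seq_lim_const (- (1))%C) Hg))).
  replace (c * (s - t))%C with (c * (s + - (1) * t))%C by ring.
  apply (seq_lim_ext_eventually _ _ _ O) with (2 := H). intros n _.
  rewrite <- csum_scal, <- csum_plus, <- csum_scal. apply csum_ext; intros; ring. }
intros (s1 & s2 & H1 & H2 & ->) (t1 & t2 & H3 & H4 & ->).
exists (c * (s1 - t1))%C, (c * (s2 - t2))%C; split; [|split]; [apply H; auto|apply H; auto|ring].
Qed.

Lemma is_Zsum_ext (f g : Z -> C) s : (forall k, f k = g k) -> is_Zsum f s -> is_Zsum g s.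
Proof. intros H; rewrite (functional_extensionality _ _ H); easy. Qed.

Lemma rsum_ge_term {T} (f : T -> R) L x : (forall y, 0 <= f y) -> In x L -> f x <= rsum f L.
Proof.
intros Hf; induction L as [|a L IH]; simpl; intros [].
- subst. assert (H := rsum_ge0 f L Hf); lra.
- specialize (IH H); specialize (Hf a); lra.
Qed.

Lemma seq_lim_bounded u l : seq_lim u l -> exists B, forall n, Cmod (u n) <= B.
Proof.
intros H. destruct (H 1) as [N HN]; [lra|].
set (r := rsum (fun n => Cmod (u n)) (seq 0 N)).
assert (Hr : 0 <= r) by (apply rsum_ge0; intros; apply Cmod_ge_0).
exists (Cmod l + 1 + r). intros n. destruct (Nat.le_gt_cases N n) as [Hn|Hn].
- specialize (HN n Hn). replace (u n) with (l + (u n - l))%C by ring.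
  eapply Rle_trans; [apply Cmod_triangle|lra].
- assert (Cmod (u n) <= r).
  { apply (rsum_ge_term (fun n => Cmod (u n))); [intros; apply Cmod_ge_0|apply in_seq; lia]. }
  assert (Hl := Cmod_ge_0 l); lra.
Qed.

(** Only convergence is known for an arbitrary string family; bounded terms are what the uniqueness
    argument extracts from it. *)
Lemma is_Zsum_bounded f s : is_Zsum f s -> exists B, forall k, Cmod (f k) <= B.
Proof.
assert (H : forall (f : nat -> C) s, is_series (V := C_R_NormedModule) f s ->
  exists B, forall n, Cmod (f n) <= B).
{ clear; intros f s. rewrite is_series_csum; intros H. destruct (seq_lim_bounded _ _ H) as [B HB].
  exists (B + B). intros [|n].
  - specialize (HB O). simpl in HB. rewrite Cplus_0_r in HB. assert (H0 := Cmod_ge_0 (f O)). lra.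
  - assert (H1 := HB n). assert (H2 := HB (S n)).
    rewrite (seq_S (S n)), csum_app in H2; simpl csum in H2 at 2. simpl plus in H2.
    replace (f (S n)) with ((csum f (seq 0 (S n)) + (f (S n) + 0)) + - csum f (seq 0 (S n)))%C by ring.
    eapply Rle_trans; [apply Cmod_triangle|]. rewrite Cmod_opp. lra. }
intros (s1 & s2 & H1 & H2 & _).
destruct (H _ _ H1) as [B1 HB1]. destruct (H _ _ H2) as [B2 HB2].
exists (B1 + B2). intros k. assert (P1 := Rle_trans _ _ _ (Cmod_ge_0 _) (HB1 O)).
assert (P2 := Rle_trans _ _ _ (Cmod_ge_0 _) (HB2 O)).
destruct (Z_le_gt_dec 0 k) as [Hk|Hk].
- specialize (HB1 (Z.to_nat k)). rewrite Z2Nat.id in HB1 by auto. lra.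
- specialize (HB2 (Z.to_nat (- k - 1))).
  replace (- Z.of_nat (S (Z.to_nat (- k - 1))))%Z with k in HB2 by lia. lra.
Qed.

Definition fourier_null (a : Z -> C) : Prop :=
  abs_summable a /\
  forall phi : R, has_sum (fun k => (a k * epow 1 (phi * IZR k))%C) (RtoC 0).

(** Averaging the angles [phi / 2] and [phi / 2 + 1 / 2] kills the odd terms. *)
Lemma fourier_null_even a : fourier_null a -> fourier_null (fun k => a (2 * k)%Z).
Proof.
intros [Ha H]; split; [apply (abs_summable_inj (fun k => (2 * k)%Z)); auto; intros; lia|].
intros phi.
assert (H1 := has_sum_scal (/ 2)%C _ _
  (has_sum_plus _ _ _ _ (H (phi / 2)) (H (phi / 2 + 1 / 2)))).
set (f := fun k => (/ 2 * (a k * epow 1 (phi / 2 * IZR k) * (1 + sgn k)))%C).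
assert (H2 : has_sum f (RtoC 0)).
{ replace (RtoC 0) with (/ 2 * (0 + 0))%C by field.
  revert H1; apply has_sum_ext; intros k. unfold f. rewrite sgn_epow.
  replace ((phi / 2 + 1 / 2) * IZR k) with (phi / 2 * IZR k + IZR k / 2) by field.
  rewrite epow_plus; ring. }
apply (has_sum_ext (fun k => f (2 * k)%Z)).
- intros k; unfold f. rewrite (sgn_even (2 * k) 0 k), sgn_0 by lia.
  rewrite mult_IZR. replace (phi / 2 * (2 * IZR k)) with (phi * IZR k) by field. field.
- apply (has_sum_inj (fun k => (2 * k)%Z)); auto; [intros; lia|].
  intros t; destruct (Zeven_odd_dec t) as [[y ->]%Zeven_ex|[y ->]%Zodd_ex].
  + right; exists y; easy.
  + left; unfold f. rewrite (sgn_odd (2 * y + 1) 0 y), sgn_0 by lia. ring.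
Qed.

Lemma fourier_null_pow a n : fourier_null a -> fourier_null (fun k => a (2 ^ Z.of_nat n * k)%Z).
Proof.
intros H; induction n as [|n IH].
- replace (fun k => a (2 ^ Z.of_nat 0 * k)%Z) with a; auto.
  apply functional_extensionality; intros k; f_equal. change (2 ^ Z.of_nat 0)%Z with 1%Z. lia.
- apply fourier_null_even in IH.
  replace (fun k => a (2 ^ Z.of_nat (S n) * k)%Z) with (fun k => a (2 ^ Z.of_nat n * (2 * k))%Z); auto.
  apply functional_extensionality; intros k; f_equal.
  rewrite Nat2Z.inj_succ, Z.pow_succ_r by lia. ring.
Qed.

(** After [n] halvings only the indices divisible by [2^n] remain, and all of them except 0 lie in
    the tail of the family. *)
Lemma fourier_null_0 a : fourier_null a -> a 0%Z = RtoC 0.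
Proof.
intros H. apply Cmod_eq_of_small; intros e He.
destruct (summable_tail (fun k => Cmod (a k)) e (fun k => Cmod_ge_0 _) (proj1 H) He) as (L0 & _ & HT).
(* Every [k] in [L0] satisfies [|k| <= n < 2^n], so [L0] contains no nonzero multiple of [2^n]. *)
set (n := list_max (map Z.abs_nat L0)).
assert (Hn : forall k, In k L0 -> (Z.abs k < 2 ^ Z.of_nat n)%Z).
{ intros k Hk. apply Z.le_lt_trans with (Z.of_nat n); [|apply Z.pow_gt_lin_r; lia].
  assert (F := proj1 (list_max_le (map Z.abs_nat L0) n) (le_n _)).
  rewrite Forall_forall in F. specialize (F _ (in_map _ _ _ Hk)). lia. }
set (N := (2 ^ Z.of_nat n)%Z) in *.
assert (HN : (0 < N)%Z) by (apply Z.pow_pos_nonneg; lia).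
destruct (fourier_null_pow a n H) as [_ H1]. specialize (H1 0).
assert (HE : forall k, (a (N * k)%Z * epow 1 (0 * IZR k))%C = a (N * k)%Z).
{ intros k; rewrite Rmult_0_l, epow_0; ring. }
apply (has_sum_ext _ _ _ HE) in H1.
assert (HB := has_sum_tail _ (fun k => Cmod (a (N * k)%Z)) _ (0%Z :: nil) e H1
  (fun k => Rle_refl _)).
replace (Cmod (a 0%Z - 0)%C) with (Cmod (0 - csum (fun k => a (N * k)%Z) (0%Z :: nil))%C).
- apply HB; [repeat constructor; easy|].
  intros L HL Hd. rewrite <- (rsum_map (fun k => (N * k)%Z) (fun k => Cmod (a k))).
  apply HT.
  + apply FinFun.Injective_map_NoDup; auto. intros x y E. apply Z.mul_reg_l in E; lia.
  + intros x Hx Hx'. apply in_map_iff in Hx as (y & <- & Hy).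
    specialize (Hn _ Hx'). apply (Hd y Hy). left.
    rewrite Z.abs_mul, (Z.abs_eq N) in Hn by lia. nia.
- simpl. rewrite Z.mul_0_r, <- Cmod_opp. f_equal. ring.
Qed.

Lemma fourier_null_eq a k : fourier_null a -> a k = RtoC 0.
Proof.
intros [Ha H]. apply (fourier_null_0 (fun i => a (i + k)%Z)). split; [apply abs_summable_shift; auto|].
intros phi. assert (H1 := has_sum_scal (epow 1 (- (phi * IZR k))) _ _ (has_sum_shift k _ _ (H phi))).
replace (RtoC 0) with (epow 1 (- (phi * IZR k)) * 0)%C by ring.
revert H1; apply has_sum_ext; intros i.
transitivity (a (i + k)%Z * (epow 1 (- (phi * IZR k)) * epow 1 (phi * IZR (i + k))))%C; [ring|].
rewrite <- epow_plus, plus_IZR. do 2 f_equal. ring.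
Qed.

(** * String functions as explicit coefficients *)

Section StringFunctions.

Context (tau : C) (tau_pos : 0 < Im tau).

Lemma annulus_growth w :
  Cmod (epow tau 1) < Cmod (epow w 1) < / Cmod (epow tau 1) <-> Rabs (growth w) < decay tau.
Proof.
rewrite !Cmod_epow, <- exp_Ropp. fold (decay tau). fold (growth w).
split.
- intros [H1 H2]; apply exp_lt_inv in H1, H2. apply Rabs_def1; lra.
- intros H; apply Rabs_def2 in H. split; apply exp_increasing; lra.
Qed.

Lemma WK_den_neq_0 w : Rabs (growth w) < decay tau -> growth w <> 0 -> WK_den w tau <> RtoC 0.
Proof.
intros Hw H0. rewrite WK_den_eq by auto.
repeat apply Cmult_neq_0; try apply epow_neq_0.
apply ztheta_neq_0; auto. intros E. apply (f_equal Cmod) in E.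
rewrite Cmod_zpow, Cmod_1, Rmult_1_r, <- exp_0 in E. apply exp_inv in E. apply H0; lra.
Qed.

(** The families are compared for [0 < growth < D], that is [|q| < |z| < 1], away from the excluded
    point [z = 1]. Bounded terms at [D / 4] and [3 D / 4] give geometric decay at [D / 2] for
    indices of either sign. *)
Lemma string_family_unique (p p' l : Z) c c' k :
  is_string_family p p' l tau c -> is_string_family p p' l tau c' ->
  c (2 * k + l)%Z = c' (2 * k + l)%Z.
Proof.
intros H H'. assert (Hd := decay_pos tau tau_pos). set (D := decay tau) in *.
set (E := fun k : Z => epow tau (IZR (2 * k + l) ^ 2 / (4 * level p p'))).
set (a := fun k => ((c (2 * k + l)%Z - c' (2 * k + l)%Z) * E k)%C).
assert (HZ : forall w, 0 < growth w < D ->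
   is_Zsum (fun k => (a k * epow w (- IZR k))%C) (RtoC 0)).
{ intros w Hw. assert (Hw' : Rabs (growth w) < D) by (rewrite Rabs_pos_eq; lra).
  assert (Hden := WK_den_neq_0 w Hw' (Rgt_not_eq _ _ (proj1 Hw))). apply annulus_growth in Hw'.
  assert (HH := is_Zsum_lin _ _ _ _ (epow w (IZR l / 2)) (H w Hw' Hden) (H' w Hw' Hden)).
  match type of HH with is_Zsum _ ?v => replace v with (RtoC 0) in HH by ring end.
  revert HH; apply is_Zsum_ext; intros i; cbv zeta. unfold a, E.
  replace (- IZR i) with (IZR l / 2 + - (IZR (2 * i + l) / 2)) by (rewrite plus_IZR, mult_IZR; field).
  rewrite epow_plus; ring. }
set (W := fun g : R => (0, g / (2 * PI)) : C).
assert (HW : forall g, growth (W g) = g).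
{ intros g; unfold growth, W; simpl. field. apply PI_neq0. }
assert (HB : forall g, 0 < g < D -> exists B, 0 <= B /\ forall i, Cmod (a i) * exp (g * IZR i) <= B).
{ intros g Hg. assert (Hg' : 0 < growth (W g) < D) by (rewrite HW; auto).
  destruct (is_Zsum_bounded _ _ (HZ (W g) Hg')) as [B HB]. exists B; split.
  - eapply Rle_trans; [apply Cmod_ge_0|apply (HB 0%Z)].
  - intros i. specialize (HB i). rewrite Cmod_mult, Cmod_epow in HB. fold (growth (W g)) in HB.
    rewrite HW in HB. replace (g * IZR i) with (- (g * - IZR i)) by ring. auto. }
destruct (HB (D / 4)) as (B1 & P1 & H1); [lra|].
destruct (HB (3 * D / 4)) as (B2 & P2 & H2); [lra|].
set (b := fun i => (a i * epow (W (D / 2)%R) (- IZR i))%C).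
assert (Hb : abs_summable b).
{ apply (abs_summable_le _ (fun i => (B1 + B2) * exp (- (D / 4 * Rabs (IZR i))))).
  - intros i; unfold b. rewrite Cmod_mult, Cmod_epow. fold (growth (W (D / 2)%R)). rewrite HW.
    specialize (H1 i); specialize (H2 i).
    assert (He := exp_pos (- (D / 4 * Rabs (IZR i)))).
    destruct (Rle_lt_dec 0 (IZR i)) as [Hi|Hi].
    + replace (- (D / 2 * - IZR i)) with (3 * D / 4 * IZR i + - (D / 4 * Rabs (IZR i)))
        by (rewrite Rabs_pos_eq by auto; field).
      rewrite exp_plus, <- Rmult_assoc. apply Rmult_le_compat_r; lra.
    + replace (- (D / 2 * - IZR i)) with (D / 4 * IZR i + - (D / 4 * Rabs (IZR i)))
        by (rewrite Rabs_left by auto; field).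
      rewrite exp_plus, <- Rmult_assoc. apply Rmult_le_compat_r; lra.
  - apply summable_scal; [lra|]. apply summable_exp_abs; lra. }
assert (HF : fourier_null b).
{ split; auto. intros phi.
  (* A real translation of [w] moves [z] along its circle and so supplies the angle [phi]. *)
  set (w := (W (D / 2)%R + RtoC (- phi) * 1)%C).
  assert (Hg : growth w = D / 2).
  { rewrite <- (HW (D / 2)). unfold growth, w; simpl. ring. }
  assert (HZw := HZ w ltac:(rewrite Hg; lra)).
  assert (Ew : forall i, (a i * epow w (- IZR i))%C = (b i * epow 1 (phi * IZR i))%C).
  { intros i. unfold w, b. rewrite epow_add, epow_scal.
    replace (- phi * - IZR i) with (phi * IZR i) by ring. ring. }
  apply (is_Zsum_ext _ _ _ Ew) in HZw. apply is_Zsum_has_sum; auto.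
  apply (abs_summable_le _ (fun i => Cmod (b i))); auto.
  intros i. rewrite Cmod_mult, Cmod_epow. simpl.
  replace (- (2 * PI * 0 * (phi * IZR i))) with 0 by ring. rewrite exp_0; lra. }
assert (Hk := fourier_null_eq b k HF). unfold b, a in Hk.
assert (N1 := epow_neq_0 (W (D / 2)) (- IZR k)). assert (N2 : E k <> RtoC 0) by apply epow_neq_0.
set (X := epow (W (D / 2)%R) (- IZR k)) in *.
transitivity (c' (2 * k + l)%Z + ((c (2 * k + l)%Z - c' (2 * k + l)%Z) * E k * X) / (E k * X))%C.
- field; auto.
- rewrite Hk; field; auto.
Qed.

(** For [m = 2 k + l], [z^(-m/2) = z^(-l/2) z^u] with [u = (l - m) / 2 = -k], and the part
    [- m^2 / (4 N)] of [s_exp] cancels the prescribed power of [q]. *)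
Lemma string_family_exists (p p' l : Z) : (0 < p)%Z -> (0 < p')%Z ->
  is_string_family p p' l tau (fun m =>
    (epow tau (s_exp p p' m l) * scoef tau p p' l ((l - m) / 2) / kappa tau)%C).
Proof.
intros Hp Hp' w Hw Hden. apply annulus_growth in Hw.
assert (Ht : ztheta tau w <> RtoC 0).
{ intros E; apply Hden. rewrite WK_den_eq, E by auto. ring. }
assert (HK := kappa_neq_0 tau tau_pos).
destruct (character_expansion tau tau_pos p p' l w Hp Hp' Hw Ht) as [HS HE].
set (e := (- (1 / 8) + IZR p * IZR (l + 1) ^ 2 / (4 * IZR p'))) in *.
set (c := (epow tau e * epow w (- (IZR l / 2)) / kappa tau)%C).
assert (EQ : forall k, (c * (scoef tau p p' l (0 - k) * zpow w (0 - k)))%C =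
  (let m := (2 * k + l)%Z in
   epow tau (s_exp p p' m l) * scoef tau p p' l ((l - m) / 2) / kappa tau *
   epow tau (IZR m ^ 2 / (4 * level p p')) * epow w (- (IZR m / 2)))%C).
{ intros k; cbv zeta.
  replace ((l - (2 * k + l)) / 2)%Z with (0 - k)%Z
    by (replace (l - (2 * k + l))%Z with ((0 - k) * 2)%Z by ring; rewrite Z.div_mul; lia).
  transitivity (epow tau (s_exp p p' (2 * k + l) l) * epow tau (IZR (2 * k + l) ^ 2 / (4 * level p p'))
    * scoef tau p p' l (0 - k) / kappa tau * epow w (- (IZR (2 * k + l) / 2)))%C; [|field; auto].
  rewrite <- epow_plus.
  replace (s_exp p p' (2 * k + l) l + IZR (2 * k + l) ^ 2 / (4 * level p p')) with e
    by (unfold s_exp, e; ring).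
  replace (- (IZR (2 * k + l) / 2)) with (- (IZR l / 2) + IZR (0 - k))
    by (rewrite plus_IZR, mult_IZR, minus_IZR; field).
  rewrite (epow_plus w). unfold c, zpow. field; auto. }
apply (is_Zsum_ext _ _ _ EQ), is_Zsum_has_sum.
- apply abs_summable_scal, (abs_summable_reflect 0 _ HS).
- apply (has_sum_reflect 0), (has_sum_scal c) in HE.
  match type of HE with has_sum _ ?v => replace v with (chi p p' l w tau) in HE end; [exact HE|].
  unfold c. rewrite !epow_opp. field. repeat split; auto; apply epow_neq_0.
Qed.

Lemma nstring_fun_scoef (p p' m l k : Z) : (0 < p)%Z -> (0 < p')%Z -> (m = 2 * k + l)%Z ->
  (Cpow (qpoch_inf (epow tau 1)) 3 * nstring_fun p p' m l tau)%C = scoef tau p p' l (- k).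
Proof.
intros Hp Hp' ->. rewrite <- kappa_qpoch by auto.
assert (HF := string_family_exists p p' l Hp Hp').
assert (HK := kappa_neq_0 tau tau_pos).
assert (Ek : ((l - (2 * k + l)) / 2)%Z = (- k)%Z).
{ replace (l - (2 * k + l))%Z with ((- k) * 2)%Z by ring. apply Z.div_mul; lia. }
assert (E : string_fun p p' (2 * k + l) l tau =
  (epow tau (s_exp p p' (2 * k + l) l) * scoef tau p p' l (- k) / kappa tau)%C).
{ unfold string_fun. apply (iota_unique (V := C_R_CompleteNormedModule)).
  - intros y (c & Hc & ->). rewrite (string_family_unique p p' l _ _ k Hc HF).
    rewrite Ek; easy.
  - eexists; split; [exact HF|]. cbv beta. rewrite Ek; easy. }
unfold nstring_fun. rewrite E, epow_opp. field; split; auto; apply epow_neq_0.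
Qed.

End StringFunctions.

(** * The difference of the two string functions *)

Lemma has_sum_csum {S T} (f : S -> T -> C) (s : S -> C) L :
  (forall x, has_sum (f x) (s x)) -> has_sum (fun k => csum (fun x => f x k) L) (csum s L).
Proof.
intros H; induction L as [|a L IH]; simpl; [apply has_sum_zero|].
apply has_sum_plus; auto.
Qed.

Lemma sum_n_m_csum (f : nat -> C) n :
  sum_n_m (G := C_AbelianMonoid) f 1 n = csum f (seq 1 n).
Proof.
induction n as [|n IH]; [apply (sum_n_m_zero (G := C_AbelianMonoid)); lia|].
rewrite (sum_n_Sm (G := C_AbelianMonoid)) by lia. rewrite IH, seq_S, csum_app; simpl.
change (csum f (seq 1 n) + f (S n) = csum f (seq 1 n) + (f (S n) + 0))%C. ring.
Qed.

Section Identity.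

Context (tau : C) (tau_pos : 0 < Im tau).

(** The minus sign in the argument cancels the alternating sign of the theta series. *)
Lemma jtheta_sum (a b : Z) : (0 < b)%Z ->
  has_sum (fun k => mono tau 0 (b * binom2 k + a * k))
    (jtheta (- epow tau (IZR a))%C (epow tau (IZR b))).
Proof.
intros Hb.
assert (HS : abs_summable (fun k => mono tau 0 (b * binom2 k + a * k))).
{ apply (abs_summable_mono tau tau_pos (fun _ => 0%Z) _ b (2 * a - b) 0); auto.
  intros k. assert (B := binom2_spec k). nia. }
assert (E : forall k, mono tau 0 (b * binom2 k + a * k) =
  (Cpowz (RtoC (-1)) k * Cpowz (epow tau (IZR b)) (binom2 k) * Cpowz (- epow tau (IZR a)) k)%C).
{ intros k. replace (- epow tau (IZR a))%C with (RtoC (-1) * epow tau (IZR a))%C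
    by (replace (RtoC (-1)) with (- (1))%C by (rewrite <- sgn_1; unfold sgn; simpl; ring); ring).
  rewrite Cpowz_mult by (apply RtoC_m1_neq_0 || apply epow_neq_0).
  rewrite !Cpowz_epow. fold (sgn k).
  transitivity ((sgn k * sgn k) * (epow tau (IZR b * IZR (binom2 k)) * epow tau (IZR a * IZR k)))%C; [|ring].
  rewrite sgn_sqr, <- epow_plus. unfold mono. rewrite sgn_0, plus_IZR, !mult_IZR; easy. }
unfold jtheta. rewrite (functional_extensionality _ _ E) in HS |- *.
apply has_sum_Zsum, HS.
Qed.

Lemma rcoef_add (b : Z) (n : nat) : rcoef tau b =
  (csum (fun k : nat => let m := Z.of_nat k in mono tau m (binom2 (m + 1) + b * m)) (seq 0 n)
   + mono tau (Z.of_nat n) (binom2 (Z.of_nat n + 1) + b * Z.of_nat n)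
     * rcoef tau (b + Z.of_nat n))%C.
Proof.
induction n as [|n IH].
- simpl csum. simpl Z.of_nat. rewrite Z.add_0_r, Z.mul_0_r.
  change (binom2 (0 + 1) + 0)%Z with 0%Z. rewrite mono_0; ring.
- rewrite IH, seq_S, csum_app.
  set (f := fun k : nat => let m := Z.of_nat k in mono tau m (binom2 (m + 1) + b * m)).
  set (N := Z.of_nat n).
  replace (csum f ((0 + n)%nat :: nil)) with (mono tau N (binom2 (N + 1) + b * N))
    by (unfold N, f; simpl; ring).
  replace (Z.of_nat (S n)) with (N + 1)%Z by (unfold N; lia).
  assert (R := rcoef_succ tau tau_pos (b + N)).
  replace (rcoef tau (b + N)) with (1 - mono tau 0 (b + N + 1) * rcoef tau (b + N + 1))%C
    by (rewrite <- R; ring).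
  replace (b + (N + 1))%Z with (b + N + 1)%Z by ring.
  rewrite (mono_opp tau (N + 1) _ (N + 0) (binom2 (N + 1) + b * N + (b + N + 1)) 0);
    [rewrite <- mono_mul; ring|lia|].
  assert (B1 := binom2_spec (N + 1)). assert (B2 := binom2_spec (N + 1 + 1)). lia.
Qed.

(** Each half of [scoef] is summable by itself, so the two halves can be reindexed differently. *)
Lemma mono_rcoef_summable (e h : Z -> Z) (a b c : Z) :
  (0 < a)%Z -> (forall k, 2 * e k = a * (k * k) + b * k + c)%Z ->
  abs_summable (fun k => (mono tau 0 (e k) * rcoef tau (h k))%C).
Proof.
intros Ha He. destruct (rcoef_bound tau tau_pos) as (K & HK & H).
apply (abs_summable_le _ (fun k => K * Cmod (mono tau 0 (e k)))).
- intros k. rewrite Cmod_mult, Rmult_comm. apply Rmult_le_compat_r; [apply Cmod_ge_0|apply H].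
- apply summable_scal; auto. apply (abs_summable_mono tau tau_pos (fun _ => 0%Z) e a b c); auto.
Qed.

Definition jdiff (p p' r n : Z) : C :=
  (jtheta (- epow tau (IZR (n * p' - 2 * p * r))) (epow tau (IZR (2 * p * p')))
   - epow tau (IZR (2 * r * (n - p)))
     * jtheta (- epow tau (IZR (n * p' + 2 * p * r))) (epow tau (IZR (2 * p * p'))))%C.

Lemma mono_even e : mono tau 0 e = epow tau (IZR e).
Proof. unfold mono; rewrite sgn_0; ring. Qed.

Lemma jdiff_0 p p' r : (0 < p)%Z -> (0 < p')%Z -> jdiff p p' r 0 = RtoC 0.
Proof.
intros Hp Hp'. assert (Hb : (0 < 2 * p * p')%Z) by nia.
assert (H1 := jtheta_sum (0 * p' - 2 * p * r) _ Hb).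
assert (H2 := has_sum_scal (mono tau 0 (2 * r * (0 - p))) _ _
  (has_sum_reflect 1 _ _ (jtheta_sum (0 * p' + 2 * p * r) _ Hb))).
unfold jdiff. rewrite mono_even in H2.
set (J1 := jtheta (- epow tau (IZR (0 * p' - 2 * p * r)))%C _) in *.
set (J2 := jtheta (- epow tau (IZR (0 * p' + 2 * p * r)))%C _) in *.
assert (E : J1 = (epow tau (IZR (2 * r * (0 - p))) * J2)%C); [|rewrite E; ring].
apply (has_sum_unique _ _ _ H1).
revert H2; apply has_sum_ext; intros k.
rewrite <- mono_even, mono_mul. apply (mono_eq _ _ _ _ _ 0); [lia|].
assert (B1 := binom2_spec k). assert (B2 := binom2_spec (1 - k)).
replace (binom2 (1 - k)) with (binom2 k) by lia. ring.
Qed.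

(** The range of [n] starts at 0 because [p] steps of the recurrence produce [p] monomials. *)
Lemma scoef_difference (p p' r i : Z) : (0 < p)%Z -> (0 < p')%Z ->
  (scoef tau p p' (2 * r - 1) (r - i)
   - mono tau (p + 1) (p * (i - r) + binom2 p) * scoef tau p p' (p' - 2 * r - 1) (p' - p - r - i))%C
  = csum (fun n0 : nat => let n := Z.of_nat n0 in
      (mono tau p (binom2 p + p * (i + r)) *
        (mono tau n (binom2 (n + 1) - n * (i + p + r)) * jdiff p p' r n))%C) (seq 0 (Z.to_nat p)).
Proof.
intros Hp Hp'.
assert (Hpp : (0 < 2 * p * p')%Z) by nia.
set (u := mono tau (p + 1) (p * (i - r) + binom2 p)).
set (e1 := fun k => (p * (p' * (k * k) + (p' - 2 * r - 1 + 1) * k))%Z).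
assert (HX : abs_summable (fun k => (mono tau 0 (e1 k) * rcoef tau (p' - p - r - i + p' * k))%C)).
{ apply (mono_rcoef_summable e1 _ (2 * p * p') (2 * p * (p' - 2 * r)) 0); auto.
  intros k; unfold e1; ring. }
assert (HY : abs_summable (fun k => (mono tau 0 (e1 k) *
   rcoef tau (p' - p - r - i - p' * k - (p' - 2 * r - 1) - 1))%C)).
{ apply (mono_rcoef_summable e1 _ (2 * p * p') (2 * p * (p' - 2 * r)) 0); auto.
  intros k; unfold e1; ring. }
destruct (has_sum_exists _ HX) as [X HXs]. destruct (has_sum_exists _ HY) as [Y HYs].
assert (E2 : scoef tau p p' (p' - 2 * r - 1) (p' - p - r - i) = (X - Y)%C).
{ apply (has_sum_unique _ _ _ (scoef_sum tau tau_pos p p' _ _ Hp Hp')).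
  generalize (has_sum_minus _ _ _ _ HXs HYs). apply has_sum_ext; intros k.
  unfold wcoef, e1. ring. }
rewrite E2.
assert (H1 := scoef_sum tau tau_pos p p' (2 * r - 1) (r - i) Hp Hp').
(* The reflections [k -> -1 - k] and [k -> -k] bring the arguments of [rcoef] to those of the first
   string function lowered by [p]. *)
assert (HD := has_sum_minus _ _ _ _ H1 (has_sum_scal u _ _
  (has_sum_minus _ _ _ _ (has_sum_reflect (-1) _ _ HXs) (has_sum_reflect 0 _ _ HYs)))).
apply (has_sum_unique _ _ _ HD).
set (v := mono tau p (binom2 p + p * (i + r))).
set (y := fun n => mono tau n (binom2 (n + 1) - n * (i + p + r))).
(* The first theta series is reflected so that its term of index [k] is the monomial coming from the
   half [X]. *)
assert (HT : forall n0 : nat, let n := Z.of_nat n0 in has_sum (fun k =>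
   (v * (y n * (mono tau 0 (2 * p * p' * binom2 (0 - k) + (n * p' - 2 * p * r) * (0 - k))
     - mono tau 0 (2 * r * (n - p)) * mono tau 0 (2 * p * p' * binom2 k + (n * p' + 2 * p * r) * k))))%C)
   (v * (y n * jdiff p p' r n))%C).
{ intros n0 n. do 2 apply has_sum_scal. unfold jdiff. rewrite <- (mono_even (2 * r * (n - p))).
  apply has_sum_minus; [|apply has_sum_scal, jtheta_sum; auto].
  apply (has_sum_reflect 0 (fun k => mono tau 0 (2 * p * p' * binom2 k + (n * p' - 2 * p * r) * k))).
  apply jtheta_sum; auto. }
assert (HC := has_sum_csum _ _ (seq 0 (Z.to_nat p)) HT). cbv zeta in HC |- *.
revert HC; apply has_sum_ext; intros k.
replace (p' - p - r - i + p' * (-1 - k))%Z with (- p - r - i - p' * k)%Z by ring.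
replace (p' - p - r - i - p' * (0 - k) - (p' - 2 * r - 1) - 1)%Z with (- p + r - i + p' * k)%Z by ring.
rewrite (rcoef_add (- p - r - i - p' * k) (Z.to_nat p)), (rcoef_add (- p + r - i + p' * k) (Z.to_nat p)).
rewrite Z2Nat.id by lia. cbv zeta.
replace (- p - r - i - p' * k + p)%Z with (- r - i - p' * k)%Z by ring.
replace (- p + r - i + p' * k + p)%Z with (r - i + p' * k)%Z by ring.
replace (r - i - p' * k - (2 * r - 1) - 1)%Z with (- r - i - p' * k)%Z by ring.
assert (B0 := binom2_spec p). assert (B1 := binom2_spec (p + 1)).
set (A1 := rcoef tau (- r - i - p' * k)). set (A2 := rcoef tau (r - i + p' * k)).
(* The prefactor [u] is what makes this product equal to [- wcoef]; with [F2], all terms in [A1] and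
   [A2] cancel. The exponents agree because [2 binom2 p = p^2 - p]. *)
assert (F1 : (u * mono tau 0 (e1 (-1 - k)%Z) *
   mono tau p (binom2 (p + 1) + (- p - r - i - p' * k) * p) = - wcoef tau p p' (2 * r - 1) k)%C).
{ unfold u, wcoef, e1. rewrite !mono_mul. apply (mono_opp _ _ _ _ _ p); [lia|].
  replace (binom2 (p + 1)) with (binom2 p + p)%Z by lia.
  assert (E : (2 * binom2 p + p - p * p = 0)%Z) by lia.
  transitivity (p * (p' * (k * k) + (2 * r - 1 + 1) * k) + (2 * binom2 p + p - p * p))%Z; [ring|lia]. }
assert (F2 : (u * mono tau 0 (e1 (0 - k)%Z) *
   mono tau p (binom2 (p + 1) + (- p + r - i + p' * k) * p) = - wcoef tau p p' (2 * r - 1) k)%C).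
{ unfold u, wcoef, e1. rewrite !mono_mul. apply (mono_opp _ _ _ _ _ p); [lia|].
  replace (binom2 (p + 1)) with (binom2 p + p)%Z by lia.
  assert (E : (2 * binom2 p + p - p * p = 0)%Z) by lia.
  transitivity (p * (p' * (k * k) + (2 * r - 1 + 1) * k) + (2 * binom2 p + p - p * p))%Z; [ring|lia]. }
match goal with |- _ = (?w * (A2 - A1) - u * (?E1 * (?S1 + ?M1 * A1) - ?E2 * (?S2 + ?M2 * A2)))%C =>
  transitivity (w * (A2 - A1) - u * (E1 * S1) - (u * E1 * M1) * A1 + u * (E2 * S2)
    + (u * E2 * M2) * A2)%C; [|ring] end.
rewrite F1, F2.
match goal with |- _ = (?w * (A2 - A1) - ?P - - ?w * A1 + ?Q + - ?w * A2)%C =>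
  transitivity (- (1) * P + Q)%C; [|ring] end.
rewrite <- !csum_scal, <- csum_plus. apply csum_ext. intros n0 _.
set (n := Z.of_nat n0). unfold v, y, u, e1.
assert (B2 := binom2_spec k). assert (B3 := binom2_spec (0 - k)).
replace (2 * p * p' * binom2 (0 - k))%Z with (p * p' * (k * k + k))%Z
  by (transitivity (p * p' * (2 * binom2 (0 - k)))%Z; [rewrite B3|]; ring).
replace (2 * p * p' * binom2 k)%Z with (p * p' * (k * k - k))%Z
  by (transitivity (p * p' * (2 * binom2 k))%Z; [rewrite B2|]; ring).
rewrite (mono_opp tau (p + 1) _ p (p * (i - r) + binom2 p) 0) by lia.
match goal with |- (?a * (?b * (?c - ?d * ?e)))%C = (?o * (- ?f * (?g * ?h)) + - ?f * (?g' * ?h'))%C =>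
  transitivity (a * b * c - a * b * d * e)%C; [ring|];
  transitivity (f * g * h - f * g' * h')%C; [|ring] end.
rewrite !mono_mul. f_equal; apply (mono_eq _ _ _ _ _ 0); ring.
Qed.

End Identity.

Theorem theorem2p2 :
  forall (tau : C) (p j i r : Z),
    0 < Im tau ->
    (1 <= p)%Z ->
    Z.Odd j ->
    (2 <= 2 * p + j)%Z ->
    Z.gcd p (2 * p + j) = 1%Z ->
    (0 <= 2 * r - 1 <= 2 * p + j - 2)%Z ->
    let q : Z -> C := fun a => epow tau (IZR a) in
    let sgn : Z -> C := Cpowz (RtoC (-1)) in
    let p' : Z := (2 * p + j)%Z in
    (Cpow (qpoch_inf (q 1%Z)) 3 * nstring_fun p p' (2 * i - 1) (2 * r - 1) tau
     = sgn (p + 1)%Z * q (p * (i - r) + binom2 p)%Z * Cpow (qpoch_inf (q 1%Z)) 3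
         * nstring_fun p p' (2 * i - 1 - j) (2 * p - 2 * r + j - 1) tau
       + sgn p * q (binom2 p + p * (i + r))%Z
         * sum_n_m (G := C_AbelianMonoid)
             (fun m0 : nat =>
                let m := Z.of_nat m0 in
                sgn m * q (binom2 (m + 1) - m * (i + p + r))%Z
                * (jtheta (- q (m * p' - 2 * p * r)%Z) (q (2 * p * p')%Z)
                   - q (2 * r * (m - p))%Z
                     * jtheta (- q (m * p' + 2 * p * r)%Z) (q (2 * p * p')%Z)))
             1 (Z.to_nat (p - 1)))%C.
Proof.
intros tau p j i r Htau Hp _ Hp' _ _ q s p'.
assert (Hp0 : (0 < p)%Z) by lia. assert (Hp'0 : (0 < p')%Z) by (unfold p'; lia).
(* The witnesses here and in [N2] are half the difference of the two indices of the string
   function. *)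
assert (N1 := nstring_fun_scoef tau Htau p p' (2 * i - 1) (2 * r - 1) (i - r) Hp0 Hp'0 ltac:(lia)).
assert (N2 := nstring_fun_scoef tau Htau p p' (2 * i - 1 - j) (2 * p - 2 * r + j - 1)
  (i - j - p + r) Hp0 Hp'0 ltac:(lia)).
change (epow tau 1) with (q 1%Z) in N1, N2.
rewrite <- (Cmult_assoc (s (p + 1)%Z * q (p * (i - r) + binom2 p)%Z)%C), N1, N2.
assert (D := scoef_difference tau Htau p p' r i Hp0 Hp'0).
replace (- (i - r))%Z with (r - i)%Z by ring.
replace (- (i - j - p + r))%Z with (p' - p - r - i)%Z by (unfold p'; ring).
replace (2 * p - 2 * r + j - 1)%Z with (p' - 2 * r - 1)%Z by (unfold p'; ring).
change (s (p + 1)%Z * q (p * (i - r) + binom2 p)%Z)%C with (mono tau (p + 1) (p * (i - r) + binom2 p)).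
change (s p * q (binom2 p + p * (i + r))%Z)%C with (mono tau p (binom2 p + p * (i + r))).
(* Splitting off [n = 0], which vanishes by [jdiff_0], leaves the range from 1 to [p - 1]. *)
replace (Z.to_nat p) with (S (Z.to_nat (p - 1))) in D by lia.
simpl seq in D. simpl csum in D. rewrite jdiff_0, !Cmult_0_r, Cplus_0_l in D by auto.
rewrite csum_scal in D. rewrite sum_n_m_csum.
match goal with |- _ = (_ + _ * ?S)%C =>
  match type of D with _ = (_ * ?S')%C => change S with S' end end.
rewrite <- D. ring.
Qed.
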